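(* Let $\nu,\alpha\in(0,1]$, let $\mathcal{N}$ be a nonlinear pure birth process with pairwise distinct rates $\lambda_k>0$, $k\ge1$, and $\mathcal{N}(0)=1$, and for $\beta\in(0,1]$ let $\mathcal{N}^\beta$ be the corresponding fractional nonlinear pure birth process of order $\beta$. With $T_{2\alpha}(t)$ independent of $\mathcal{N}^\nu$, and with $T_{2\nu}$, $T_{2\alpha}$, $\mathcal{N}$ mutually independent, one has for every $t>0$ the equalities in distribution $$\mathcal{N}^\nu(T_{2\alpha}(t))=\mathcal{N}\bigl(T_{2\nu}(T_{2\alpha}(t))\bigr)=\mathcal{N}(T_{2\nu\alpha}(t))=\mathcal{N}^{\nu\alpha}(t).$$ In particular $\Pr\{\mathcal{N}^\nu(T_{2\alpha}(t))=k\}=\prod_{j=1}^{k-1}\lambda_j\sum_{m=1}^k\frac{E_{\nu\alpha,1}(-\lambda_mt^{\nu\alpha})}{\prod_{l=1,l\neq m}^k(\lambda_l-\lambda_m)}$ for $k\ge2$, and $\Pr\{\mathcal{N}^\nu(T_{2\alpha}(t))=1\}=E_{\nu\alpha,1}(-\lambda_1t^{\nu\alpha})$.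
   Context: The nonlinear pure birth process with rates $(\lambda_k)$ is the continuous-time Markov chain on $\{1,2,\dots\}$ started at $1$ which from $k$ jumps only to $k+1$, at rate $\lambda_k$; it is assumed that $\sum_k1/\lambda_k=\infty$. $E_{\beta,1}(x)=\sum_{h\ge0}x^h/\Gamma(\beta h+1)$ is the Mittag--Leffler function. The fractional process $\mathcal{N}^\beta$, $\beta\in(0,1]$, has state probabilities $\Pr\{\mathcal{N}^\beta(t)=1\}=E_{\beta,1}(-\lambda_1t^\beta)$ and, for $k>1$, $\Pr\{\mathcal{N}^\beta(t)=k\}=\prod_{j=1}^{k-1}\lambda_j\sum_{m=1}^k\frac{E_{\beta,1}(-\lambda_mt^\beta)}{\prod_{l=1,l\ne m}^k(\lambda_l-\lambda_m)}$. For $\beta\in(0,1)$, $T_{2\beta}(t)$ is a nonnegative random time whose density in $s>0$ is $t^{-\beta}W_{-\beta,1-\beta}(-s/t^\beta)$, with $W_{-\beta,1-\beta}(-\xi)=\sum_{r\ge0}\frac{(-\xi)^r}{r!\,\Gamma(1-\beta(r+1))}$ (with $1/\Gamma=0$ at the poles of $\Gamma$); it is the folded solution at time $t$ of $\partial_t^{2\beta}g=\partial_x^2g$, $g(x,0)=\delta(x)$ (with $g_t(x,0)=0$ if $1/2<\beta\le1$). For $\beta=1$, $T_2(t)=t$. Equality in distribution refers to one-dimensional distributions at fixed $t$. *)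

(* Defs.v *)
From HB Require Import structures.
From mathcomp Require Import all_boot all_order all_algebra.
From mathcomp Require Import all_classical all_reals all_analysis.
Set Implicit Arguments.
Unset Strict Implicit.
Unset Printing Implicit Defensive.
Import Order.TTheory GRing.Theory Num.Theory.
Import numFieldNormedType.Exports.
Local Open Scope classical_set_scope.
Local Open Scope ring_scope.

Definition gamma_integral {R : realType} (x : R) : R :=
  Rintegral (@lebesgue_measure R) `]0, +oo[
    (fun u : R => u `^ (x - 1) * expR (- u)).

(* For x <= 0, Gamma x = Gamma (x + n) / (x (x + 1) ... (x + n - 1)) with
   0 < x + n <= 1. At the poles 0, -1, -2, ... the denominator vanishes, so
   that Gamma x = 0 and (Gamma x)^-1 = 0, which is the convention 1 / Gamma = 0
   there. *)
Definition Gamma {R : realType} (x : R) : R :=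
  let n := if 0 < x then 0%N else (Num.truncn (- x)).+1 in
  gamma_integral (x + n%:R) / \prod_(i < n) (x + i%:R).

(* E_{b,1} *)
Definition mittag_leffler {R : realType} (b x : R) : R :=
  limn (series (fun h : nat => x ^+ h / Gamma (b * h%:R + 1))).

(* W_{a,b} *)
Definition wright {R : realType} (a b x : R) : R :=
  limn (series (fun r : nat => x ^+ r / (r`!%:R * Gamma (a * r%:R + b)))).

Definition eq_law {R : realType} {d d' : measure_display}
    {T : measurableType d} {E : measurableType d'} (P : probability T R)
    (X Y : T -> E) : Prop :=
  [/\ measurable_fun setT X, measurable_fun setT Y &
      forall A : set E, measurable A -> pushforward P X A = pushforward P Y A].

Section processes.
Context {R : realType} {d d' : measure_display} {T : measurableType d}
  {E : measurableType d'}.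

Definition process_events (X : R -> T -> E) : set (set T) :=
  \bigcup_(t in [set t : R | 0 <= t]) g_sigma_algebra_preimage (X t).

(* sigma (X t, t >= 0) *)
Definition sigma_process (X : R -> T -> E) : set (set T) :=
  <<s process_events X >>.

(* (s, w) |-> X s w is measurable on [0, +oo[ x T for the product of the Borel
   sigma-algebra and of sigma (X t, t >= 0); processes with right-continuous
   paths have this property. Joint measurability for the full sigma-algebra of
   T would not be enough for X to be composed with an independent random time:
   on [0, 1] with Lebesgue measure, X s w = (s == w) is independent of
   tau w = w and X s = 0 a.s. for every s, but X (tau w) w = 1. *)
Definition measurable_process (X : R -> T -> E) : Prop :=
  measurable_fun
    [set z : R * g_sigma_algebraType (process_events X) | 0 <= z.1]
    (fun z => X z.1 z.2).

End processes.

(* Product rule for a list of sigma-algebras; as each of them contains setT,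
   the rule for the sublists is included. *)
Definition mutually_independent {R : realType} {d : measure_display}
    {T : measurableType d} (P : probability T R) (Fs : seq (set (set T))) :
    Prop :=
  forall A : nat -> set T,
    (forall i, (i < size Fs)%N -> nth set0 Fs i (A i)) ->
    (P (\bigcap_(i < size Fs) A i) = \prod_(i < size Fs) P (A i))%E.

(* Transition functions and rates are indexed by nat, but only the states
   1, 2, ... matter; likewise for the values lam k of a sequence of rates. *)
Definition transition_function {R : realType} (p : R -> nat -> nat -> R) :
    Prop :=
  [/\ forall t i j, 0 <= t -> (1 <= i)%N -> (1 <= j)%N -> 0 <= p t i j,
      forall t i, 0 <= t -> (1 <= i)%N ->
        (\sum_(1 <= j <oo) (p t i j)%:E = 1)%E,
      forall i j, (1 <= i)%N -> (1 <= j)%N -> p 0 i j = (i == j)%:R &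
      forall s t i j, 0 <= s -> 0 <= t -> (1 <= i)%N -> (1 <= j)%N ->
        ((p (s + t) i j)%:E = \sum_(1 <= l <oo) (p s i l * p t l j)%:E)%E].

Definition birth_rate {R : realType} (lam : nat -> R) (i j : nat) : R :=
  if j == i.+1 then lam i else if j == i then - lam i else 0.

Definition has_birth_rates {R : realType} (lam : nat -> R)
    (p : R -> nat -> nat -> R) : Prop :=
  forall i j, (1 <= i)%N -> (1 <= j)%N ->
    (p h i j - (i == j)%:R) / h @[h --> 0^'+] --> birth_rate lam i j.

Section pure_birth.
Context {R : realType} {d : measure_display} {T : measurableType d}
  {P : probability T R}.

(* The conditional probability of N (s n.+1) = k n.+1 given N (s i) = k i,
   i <= n, is p (s n.+1 - s n) (k n) (k n.+1). *)
Definition markov_property (p : R -> nat -> nat -> R)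
    (N : R -> {RV P >-> nat}) : Prop :=
  forall (n : nat) (s : nat -> R) (k : nat -> nat),
    0 <= s 0%N -> nondecreasing_seq s -> (forall i, (1 <= k i)%N) ->
    (P (\bigcap_(i < n.+2) [set w | N (s i) w = k i]) =
     P (\bigcap_(i < n.+1) [set w | N (s i) w = k i]) *
     (p (s n.+1 - s n)%R (k n) (k n.+1))%:E)%E.

Definition pure_birth_process (lam : nat -> R) (N : R -> {RV P >-> nat}) :
    Prop :=
  [/\ forall t w, 0 <= t -> (1 <= N t w)%N,
      P [set w | N 0 w = 1%N] = 1%E &
      exists p : R -> nat -> nat -> R,
        [/\ transition_function p, has_birth_rates lam p &
            markov_property p N]].

(* Pr {N^b(t) = k} for k >= 2 *)
Definition fractional_birth_prob (lam : nat -> R) (b : R) (k : nat) (t : R) :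
    R :=
  \prod_(1 <= j < k) lam j *
  \sum_(1 <= m < k.+1) mittag_leffler b (- lam m * t `^ b) /
    \prod_(1 <= l < k.+1 | l != m) (lam l - lam m).

Definition fractional_pure_birth_process (lam : nat -> R) (b : R)
    (N : R -> {RV P >-> nat}) : Prop :=
  forall t, 0 <= t ->
  [/\ forall w, (1 <= N t w)%N,
      P [set w | N t w = 1%N] = (mittag_leffler b (- lam 1%N * t `^ b))%:E &
      forall k, (2 <= k)%N ->
        P [set w | N t w = k] = (fractional_birth_prob lam b k t)%:E].

Definition random_time_density (b t s : R) : R :=
  t `^ (- b) * wright (- b) (1 - b) (- (s / t `^ b)).

Definition random_time (b : R) (tau : R -> {RV P >-> R}) : Prop :=
  [/\ forall t w, 0 <= t -> 0 <= tau t w,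
      b < 1 -> forall t, 0 < t -> forall A : set R, measurable A ->
        P (tau t @^-1` A) =
        (\int[@lebesgue_measure R]_(s in A `&` `]0%R, +oo[)
           (random_time_density b t s)%:E)%E &
      b = 1 -> forall t w, 0 <= t -> tau t w = t].

End pure_birth.

(* Main.v *)
Require Import Defs.
From HB Require Import structures.
From mathcomp Require Import all_boot all_order all_algebra.
From mathcomp Require Import all_classical all_reals all_analysis.
From mathcomp Require Import measurable_realfun.
From mathcomp Require Import ring lra.
Set Implicit Arguments.
Unset Strict Implicit.
Unset Printing Implicit Defensive.
Import Order.TTheory GRing.Theory Num.Theory.
Import numFieldNormedType.Exports.
Local Open Scope classical_set_scope.
Local Open Scope ring_scope.

(** The Laplace transform in t of the density of T_(2b)(t) at s is
    F(p) = p^(b - 1) e^(-s p^b). The Post-Widder inversion formula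
    (n/t)^(n+1) (-1)^n F^(n)(n/t) / n! expresses the density as a limit of
    explicit nonnegative functions of s; both their Taylor coefficients in s
    and their moments are finite products which converge, by Euler's limit for
    1 / Gamma, to the coefficients of the Wright series and to
    E T_(2b)(t)^e = t^(b e) Gamma(e + 1) / Gamma(1 + b e). Expanding the
    Mittag-Leffler series, the moments give
    E E_(nu,1)(-l T_(2b)(t)^nu) = E_(nu b,1)(-l t^(nu b)), which for nu = 1 is
    the Laplace transform E e^(-l T_(2b)(t)).

    The state probabilities of N at s are fixed linear combinations of the
    e^(-lam_m s): the transition function solves the backward equations, and
    the divergence of sum 1 / lam_k excludes transitions from i to j < i (a
    return from infinity). Composing with an independent random time averages
    these combinations, and those of the E_(nu,1)(-lam_m s^nu) for N^nu, so all
    four one-dimensional laws have the same state probabilities. *)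

(** The Wright series alternates in sign, so neither the positivity nor the decay of the density can
    be read off from it. Post-Widder inversion avoids both difficulties. As [p^(b - 1) e^(-s p^b)]
    is completely monotone for [b <= 1], the approximants are nonnegative. A bound on one higher
    moment excludes loss of mass at infinity, so no decay estimate is required. The single identity
    [sum_wright_coef], evaluated at negative and at positive arguments, yields both the Taylor
    coefficients and the moments.

    No uniqueness theorem for Laplace transforms enters. The law of [T_(2nu)(T_(2alpha)(t))] is
    never identified; only its averages of [e^(-l s)] are computed, since the state probabilities
    involve nothing else.

    Two points need care on the probabilistic side. The transition function is given only by its
    rates at time 0, so its differentiability has to be derived. The composed time must be shown
    independent of [N]; this is done by conditioning on an event of [N] and observing that the law
    of the composed time does not change. *)

Local Notation pos R := ([set` `]0%R, +oo[%R] : set R).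

(** * The Gamma function *)

(** The left side is a measure in [A] that agrees with Lebesgue measure on the intervals []x, y]],
    and these values determine it. *)
Lemma lebesgue_measure_scale {R : realType} (a : R) (A : set R) : 0 < a ->
  measurable A ->
  (a%:E * pushforward (@lebesgue_measure R)
     ( *%R a : measurableTypeR R -> measurableTypeR R) A)%E = lebesgue_measure A.
Proof.
move=> a0 mA; pose a1 := NngNum (ltW a0).
have ma : measurable_fun setT ( *%R a : measurableTypeR R -> measurableTypeR R).
  by apply: measurable_funM; [exact: measurable_cst|exact: measurable_id].
pose phi : {mfun measurableTypeR R >-> measurableTypeR R} :=
  HB.pack ( *%R a : measurableTypeR R -> measurableTypeR R)
    (isMeasurableFun.Build _ _ _ _ _ ma).
apply/esym/(@lebesgue_measure_unique R
  (mscale a1 (pushforward lebesgue_measure phi))) => //= _ [[x y]] _ <-.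
rewrite /mscale /= /pushforward.
rewrite [X in (_ * lebesgue_measure X)%E](_ : _ = `]x / a, y / a]%classic).
  rewrite !lebesgue_measure_itv/= !lte_fin ltr_pM2r ?invr_gt0//.
  case: ifPn => _; last by rewrite mule0.
  by rewrite !EFinN -!EFinB -EFinM mulrBr !(mulrCA a) divff ?gt_eqF// !mulr1.
apply/seteqP; split=> z /=; rewrite !in_itv/= ltr_pdivrMr// ler_pdivlMr//;
  by rewrite (mulrC z).
Qed.

Lemma ge0_integral_scale {R : realType} (a : R) (f : R -> \bar R) : 0 < a ->
  measurable_fun (pos R) f -> {in pos R, forall x, 0 <= f x}%E ->
  (\int[lebesgue_measure]_(x in `]0%R, +oo[) f (a * x)%R =
   a^-1%:E * \int[lebesgue_measure]_(x in `]0%R, +oo[) f x)%E.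
Proof.
move=> a0 mf f0.
have E : ( *%R a : measurableTypeR R -> measurableTypeR R) @^-1` `]0, +oo[ =
         `]0, +oo[%classic.
  by apply/seteqP; split=> z /=; rewrite !in_itv/= !andbT pmulr_rgt0.
have ma : measurable_fun setT ( *%R a : measurableTypeR R -> measurableTypeR R).
  by apply: measurable_funM; [exact: measurable_cst|exact: measurable_id].
pose phi : {mfun measurableTypeR R >-> measurableTypeR R} :=
  HB.pack ( *%R a : measurableTypeR R -> measurableTypeR R)
    (isMeasurableFun.Build _ _ _ _ _ ma).
rewrite -[in LHS]E.
rewrite -(@ge0_integral_pushforward _ _ _ _ _ _ ma lebesgue_measure
  (pos R) f)//.
have a1 : 0 <= a^-1 by rewrite invr_ge0 ltW.
pose a1' := NngNum a1.
rewrite [RHS](_ : _ = \int[mscale a1' lebesgue_measure]_(x in `]0%R, +oo[) f x)%E.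
  apply: (@eq_measure_integral _ _ _ _ (mscale a1' lebesgue_measure)
   (pushforward lebesgue_measure phi)) => A mA _.
  rewrite -[RHS]/(a^-1%:E * lebesgue_measure A)%E -(lebesgue_measure_scale a0 mA).
  rewrite muleA -EFinM mulVf ?gt_eqF//.
  by rewrite mul1e.
rewrite ge0_integral_mscale//.
by move=> x x0; apply: f0; rewrite inE.
Qed.

Lemma integral_indicM {d} {T : measurableType d} {R : realType}
  (mu : {measure set T -> \bar R}) (D : set T) (f : T -> R) :
  (\int[mu]_(x in D) (f x)%:E = \int[mu]_x (\1_D x * f x)%:E)%E.
Proof.
rewrite integral_mkcond; apply: eq_integral => x _; rewrite patchE indicE.
by case: ifP => _; rewrite ?mul1r ?mul0r.
Qed.

(** The integral is kept in the extended reals so that Tonelli and monotonicity apply before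
    finiteness is known. *)
Definition egamma {R : realType} (x : R) : \bar R :=
  (\int[lebesgue_measure]_(u in `]0%R, +oo[) (u `^ (x - 1) * expR (- u))%:E)%E.

Lemma measurable_gamma_integrand {R : realType} (D : set R) (x : R) (g : R -> R) :
  measurable_fun setT g -> measurable_fun D (fun u : R => u `^ x * expR (g u)).
Proof.
move=> mg; apply: measurable_funTS; apply: measurable_funM.
  exact: measurable_powR.
exact: measurableT_comp.
Qed.

Lemma egamma_scale {R : realType} (x a : R) : 0 < a ->
  (\int[lebesgue_measure]_(u in `]0%R, +oo[)
     (u `^ (x - 1) * expR (- (a * u)))%:E = (a `^ (- x))%:E * egamma x)%E.
Proof.
move=> a0.
have mf : measurable_fun (pos R) (fun u : R => (u `^ (x - 1) * expR (- u))%:E).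
  by apply/measurable_EFinP; exact: measurable_gamma_integrand.
have := @ge0_integral_scale R a _ a0 mf.
rewrite -/(egamma x) => /(_ _)/= H.
have {H}E : (\int[lebesgue_measure]_(u in `]0%R, +oo[)
   ((a * u) `^ (x - 1) * expR (- (a * u)))%:E = a^-1%:E * egamma x)%E.
  by apply: H => u _; rewrite lee_fin mulr_ge0 ?powR_ge0 ?expR_ge0.
rewrite -[X in X `^ (- x)]/a (_ : a `^ (- x) = (a `^ (x - 1))^-1 * a^-1); last first.
  rewrite -powRN -(powR_inv1 (ltW a0)) -powRD ?(gt_eqF a0) ?implybT//.
  by congr powR; ring.
rewrite EFinM -muleA -E -ge0_integralZl//=.
- apply: eq_integral => u; rewrite inE/= in_itv/= andbT => u0.
  rewrite -EFinM powRM ?ltW// !mulrA mulVf ?mul1r//.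
  by rewrite gt_eqF// powR_gt0.
- apply/measurable_EFinP.
  apply: measurable_funM.
    by apply: (measurableT_comp (measurable_powR _)).
  by apply: measurableT_comp => //; apply: measurableT_comp => //.
- by move=> u _; rewrite lee_fin mulr_ge0 ?powR_ge0 ?expR_ge0.
- by rewrite lee_fin invr_ge0 powR_ge0.
Qed.

Lemma powR_cvgy0 {R : realType} (x : R) : 0 < x -> a `^ (- x) @[a --> +oo] --> 0.
Proof.
move=> x0; apply/cvgrPdist_le => e e0; near=> a.
have a0 : 0 < a by near: a; exact: nbhs_pinfty_gt.
rewrite sub0r normrN ger0_norm ?powR_ge0//.
have : e^-1 `^ x^-1 <= a by near: a; apply: nbhs_pinfty_ge; rewrite num_real.
move/(ge0_ler_powR (ltW x0)); rewrite !nnegrE powR_ge0 (ltW a0) => /(_ isT isT).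
rewrite -powRrM mulVf ?gt_eqF// powRr1 ?invr_ge0 ?(ltW e0)// => H.
by rewrite powRN -[e]invrK lef_pV2// posrE ?invr_gt0// powR_gt0.
Unshelve. all: by end_near. Qed.

Lemma is_derive_powR {R : realType} (a x : R) : 0 < x ->
  is_derive x 1 (fun x : R => x `^ a) (a * x `^ (a - 1)).
Proof.
move=> x0; have xp : x \in `]0%R, +oo[ by rewrite in_itv/= x0.
by apply: DeriveDef; [exact: derivable_powR|rewrite -derive1E powR_derive1].
Qed.

Lemma is_derive_continuous {R : realType} (f : R -> R) (x df : R) :
  is_derive x 1 f df -> {for x, continuous f}.
Proof.
by move=> fx; apply: differentiable_continuous; apply/derivable1_diffP; exact: ex_derive.
Qed.

Lemma integral_powR_tail {R : realType} (x : R) : 0 < x ->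
  (\int[lebesgue_measure]_(a in `[1%R, +oo[) (a `^ (- (x + 1)))%:E = (x^-1)%:E)%E.
Proof.
move=> x0.
have dF (a : R) : 0 < a ->
    is_derive a 1 (fun a => - x^-1 * a `^ (- x)) (a `^ (- (x + 1))).
  move=> a0; have ? := is_derive_powR (- x) a0.
  apply: is_derive_eq; rewrite -mulr_algl.
  rewrite mulr_algl /GRing.scale/= mulrA mulNr mulrN opprK mulVf ?gt_eqF// mul1r.
  by congr powR; ring.
rewrite (@ge0_continuous_FTC2y R _ (fun a => - x^-1 * a `^ (- x)) 1 0).
- by rewrite powR1 mulr1 sub0e EFinN oppeK.
- by move=> a _; exact: powR_ge0.
- apply: continuous_in_subspaceT => a; rewrite inE/= in_itv/= andbT => a1.
  exact: is_derive_continuous (is_derive_powR _ (lt_le_trans ltr01 a1)).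
- rewrite -[X in _ --> X](mulr0 (- x^-1)); apply: cvgMr; exact: powR_cvgy0.
- by move=> a a1; have [] := dF a (lt_trans ltr01 a1).
- apply: cvg_at_right_filter; exact: is_derive_continuous (dF 1 ltr01).
- move=> a; rewrite in_itv/= andbT => a1; rewrite derive1E.
  by have ? := dF a (lt_trans ltr01 a1); rewrite derive_val.
Qed.

Lemma integral_expR_tail {R : realType} (u : R) : 0 < u ->
  (\int[lebesgue_measure]_(a in `[1%R, +oo[) (expR (- (a * u)))%:E =
   (u^-1 * expR (- u))%:E)%E.
Proof.
move=> u0.
have dF (a : R) : is_derive a 1 (fun a => - u^-1 * expR (- (a * u))) (expR (- (a * u))).
  apply: is_derive_eq; rewrite /GRing.scale/=.
  field; exact: lt0r_neq0.
have cF (a : R) : {for a, continuous (fun a : R => expR (- (a * u)))}.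
  apply: is_derive_continuous; exact: is_deriveV.
rewrite (@ge0_continuous_FTC2y R _ (fun a => - u^-1 * expR (- (a * u))) 1 0).
- by rewrite mul1r sub0e -EFinN mulNr opprK.
- by move=> a _; exact: expR_ge0.
- apply: continuous_in_subspaceT => a _; exact: cF.
- rewrite -[X in _ --> X](mulr0 (- u^-1)); apply: cvgMr.
  apply: (@cvg_comp _ _ _ (fun a => a * u) (fun a => expR (- a)) _ +oo); last exact: cvgr_expR.
  by apply: gt0_cvgMly => //.
- by move=> a _; have [] := dF a.
- apply: cvg_at_right_filter; exact: is_derive_continuous (dF 1).
- by move=> a _; rewrite derive1E; have ? := dF a; rewrite derive_val.
Qed.

(* Integrating [int u^x e^(-a u) du = a^(-x-1) Gamma(x+1)] over [a >= 1] and
   exchanging the integrals gives the functional equation without any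
   boundary term. *)
Lemma egammaS {R : realType} (x : R) : 0 < x ->
  egamma (x + 1) = (x%:E * egamma x)%E.
Proof.
move=> x0.
pose f (z : R * R) : \bar R :=
  (\1_(`[1%R, +oo[%classic : set R) z.1 *
   (\1_(`]0%R, +oo[%classic : set R) z.2 * (z.2 `^ x * expR (- (z.1 * z.2)))))%:E.
have f0 z : (0 <= f z)%E by rewrite lee_fin !mulr_ge0 ?powR_ge0 ?expR_ge0.
have mf : measurable_fun setT f.
  apply/measurable_EFinP; apply: measurable_funM.
    exact: (measurableT_comp _ measurable_fst).
  apply: measurable_funM.
    exact: (measurableT_comp _ measurable_snd).
  apply: measurable_funM.
    by apply: (measurableT_comp (measurable_powR _)).
  apply: measurableT_comp => //; apply: measurableT_comp => //.
  by apply: measurable_funM.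
have I1 : (\int[lebesgue_measure]_x \int[lebesgue_measure]_y f (x, y) =
  egamma (x + 1) * (x^-1)%:E)%E.
  rewrite -(integral_powR_tail x0) muleC -ge0_integralZr//; first last.
    + by apply: integral_ge0 => u _; rewrite lee_fin mulr_ge0 ?powR_ge0 ?expR_ge0.
    + by move=> a _; rewrite lee_fin powR_ge0.
    + by apply/measurable_EFinP; apply: measurable_funTS; exact: measurable_powR.
  rewrite integral_mkcond; apply: eq_integral => a _.
  rewrite patchE /f/=; case: ifPn => [|aD]; last first.
    by rewrite integral0_eq// => y _; rewrite indicE (negbTE aD) mul0r.
  rewrite inE/= in_itv/= andbT => a1.
  rewrite -egamma_scale ?(lt_le_trans ltr01 a1)// addrK [RHS]integral_indicM.
  apply: eq_integral => u _; rewrite [X in X * _]indicE mem_set ?mul1r//=.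
  by rewrite in_itv/= a1.
have I2 : (\int[lebesgue_measure]_y \int[lebesgue_measure]_x f (x, y) =
  egamma x)%E.
  rewrite /egamma [RHS]integral_mkcond; apply: eq_integral => u _.
  rewrite patchE /f/=; case: ifPn => [|uD]; last first.
    by rewrite integral0_eq// => y _; rewrite [\1_(pos R) u]indicE (negbTE uD) mul0r mulr0.
  move=> uD; move: (uD); rewrite inE/= in_itv/= andbT => u0.
  transitivity (\int[lebesgue_measure]_(a in `[1%R, +oo[) (u `^ x * expR (- (a * u)))%:E)%E.
    rewrite [RHS]integral_indicM; apply: eq_integral => a _.
    by rewrite [\1_(pos R) u]indicE uD mul1r.
  under eq_integral do rewrite EFinM.
  rewrite ge0_integralZl//=.
  - rewrite integral_expR_tail// -EFinM mulrA; congr (_ * _)%:E.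
    by rewrite -(powR_inv1 (ltW u0)) -powRD// (gt_eqF u0) implybT.
  - apply/measurable_EFinP; apply: measurable_funTS.
    apply: measurableT_comp => //; apply: measurableT_comp => //.
    exact: mulrr_measurable.
  - by rewrite lee_fin powR_ge0.
have := etrans (esym I1)
  (etrans (@fubini_tonelli _ _ _ _ R lebesgue_measure lebesgue_measure f mf f0) I2).
move=> <-.
by rewrite muleCA -EFinM divff ?mule1// gt_eqF.
Qed.

Lemma egamma1 {R : realType} : egamma (1 : R) = 1%E.
Proof.
rewrite /egamma.
transitivity (\int[lebesgue_measure]_(u in `[0%R, +oo[) (expR (- u : R))%:E)%E.
  rewrite -integral_itv_obnd_cbnd.
    by apply: eq_integral => u _; rewrite subrr powRr0 mul1r.
  by apply/measurable_EFinP; apply: measurableT_comp.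
rewrite (@ge0_continuous_FTC2y R _ (fun u => - expR (- u)) 0 0).
- by rewrite oppr0 expR0 sub0e -EFinN opprK.
- by move=> a _; exact: expR_ge0.
- apply: continuous_in_subspaceT => a _.
  apply: is_derive_continuous; exact: is_deriveV.
- by rewrite -oppr0; apply: cvgN; exact: cvgr_expR.
- by [].
- apply: cvg_at_right_filter.
  have ? : is_derive (0 : R) 1 (fun u : R => - expR (- u)) (expR (- 0)).
    by apply: is_derive_eq; rewrite /GRing.scale/=; ring.
  exact: is_derive_continuous.
- move=> a _; rewrite derive1E.
  have : is_derive a 1 (fun u : R => - expR (- u)) (expR (- a)).
    by apply: is_derive_eq; rewrite /GRing.scale/=; ring.
  by move=> ?; rewrite derive_val.
Qed.

Lemma egamma_ge0 {R : realType} (x : R) : (0 <= egamma x)%E.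
Proof. by apply: integral_ge0 => u _; rewrite lee_fin mulr_ge0 ?powR_ge0 ?expR_ge0. Qed.

Lemma egamma_nat {R : realType} (n : nat) : egamma (n.+1%:R : R) = (n`!%:R)%:E.
Proof.
elim: n => [|n IH]; first exact: egamma1.
by rewrite -[n.+2]addn1 natrD egammaS// IH -EFinM -natrM factS.
Qed.

(** Passing to [x + 1] removes the singularity at 0: there the power is at most [1 + u^n], whose
    integral is known. The functional equation then carries finiteness back to [x]. *)
Lemma egamma_fin_num {R : realType} (x : R) : 0 < x -> egamma x \is a fin_num.
Proof.
move=> x0.
suff H : (egamma (x + 1) < +oo)%E.
  move: H; rewrite egammaS// ge0_fin_numE ?egamma_ge0//.
  case: (egamma x) (egamma_ge0 x) => [r _ _| |//]; first by rewrite ltry.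
  by rewrite mulry gtr0_sg// mul1e ltxx.
pose n := (Num.truncn x).+1.
have xn : x <= n%:R by rewrite ltW// /n truncnS_gt.
have meas (y : R) : measurable_fun (pos R) (fun u : R => (u `^ (y - 1) * expR (- u))%:E).
  by apply/measurable_EFinP; exact: measurable_gamma_integrand.
apply: (@le_lt_trans _ _ (egamma (1 : R) + egamma (n.+1%:R : R))%E); last first.
  by rewrite egamma1 egamma_nat -EFinD ltry.
rewrite /egamma -ge0_integralD//=; first last.
- exact: meas.
- by move=> u _; rewrite lee_fin mulr_ge0 ?powR_ge0 ?expR_ge0.
- exact: meas.
- by move=> u _; rewrite lee_fin mulr_ge0 ?powR_ge0 ?expR_ge0.
apply: ge0_le_integral => //=.
- by move=> u _; rewrite lee_fin mulr_ge0 ?powR_ge0 ?expR_ge0.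
- exact: meas.
- by apply: emeasurable_funD; exact: meas.
move=> u; rewrite in_itv/= andbT => u0; rewrite -EFinD lee_fin -mulrDl.
apply: ler_wpM2r; rewrite ?expR_ge0// addrK subrr powRr0 -natr1 addrK.
have [u1|u1] := leP 1 u.
  by rewrite (le_trans (ler_powR u1 xn))// lerDr.
rewrite (@le_trans _ _ 1) ?lerDl ?powR_ge0//.
by rewrite -[leRHS](powRr0 u) ger_powR ?u0 ?ltW.
Qed.

Lemma gamma_integralE {R : realType} (x : R) : 0 < x ->
  egamma x = (gamma_integral x)%:E.
Proof. by move=> x0; rewrite -[RHS]/(fine (egamma x))%:E fineK ?egamma_fin_num. Qed.

Lemma gamma_integralS {R : realType} (x : R) : 0 < x ->
  gamma_integral (x + 1) = x * gamma_integral x.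
Proof.
move=> x0; have := egammaS x0; rewrite !gamma_integralE ?addr_gt0// -EFinM.
by case.
Qed.

Lemma gamma_integral_nat {R : realType} (n : nat) :
  gamma_integral (n.+1%:R : R) = n`!%:R.
Proof. by have := @egamma_nat R n; rewrite gamma_integralE// => -[]. Qed.

(** The integral is restricted to [[A, A + 1]]. As [A] is arbitrary, Gamma outgrows every geometric
    sequence, which gives the convergence of the Mittag-Leffler series and a weak Stirling bound. *)
Lemma gamma_integral_ge {R : realType} (x A : R) : 1 <= x -> 0 < A ->
  A `^ (x - 1) * expR (- (A + 1)) <= gamma_integral x.
Proof.
move=> x1 A0; rewrite -lee_fin -gamma_integralE ?(lt_le_trans ltr01)//.
have sub : `[A, A + 1]%classic `<=` `]0, +oo[%classic.
  move=> u /=; rewrite !in_itv/= andbT => /andP[Au _]; exact: lt_le_trans Au.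
have meas : measurable_fun (pos R) (fun u : R => (u `^ (x - 1) * expR (- u))%:E).
  by apply/measurable_EFinP; exact: measurable_gamma_integrand.
apply: (@le_trans _ _ (\int[lebesgue_measure]_(u in `[A, (A + 1)%R])
    (u `^ (x - 1) * expR (- u))%:E)%E); last first.
  apply: ge0_subset_integral => //.
  by move=> u _; rewrite lee_fin mulr_ge0 ?powR_ge0 ?expR_ge0.
have -> : (A `^ (x - 1) * expR (- (A + 1)))%:E =
  (\int[lebesgue_measure]_(u in `[A, (A + 1)%R]) (A `^ (x - 1) * expR (- (A + 1)))%:E)%E.
  rewrite integral_cst//= lebesgue_measure_itv/= lte_fin ltrDl ltr01.
  by rewrite -EFinD addrAC subrr add0r mule1.
apply: ge0_le_integral => //=.
- by move=> u _; rewrite lee_fin mulr_ge0 ?powR_ge0 ?expR_ge0.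
- exact: measurable_funS meas.
move=> u; rewrite in_itv/= => /andP[Au uA]; rewrite lee_fin ler_pM ?powR_ge0 ?expR_ge0//.
  by rewrite ge0_ler_powR ?subr_ge0// nnegrE ?(le_trans (ltW A0) Au) ?(ltW A0).
by rewrite ler_expR lerN2.
Qed.

Lemma gamma_integral_gt0 {R : realType} (x : R) : 0 < x -> 0 < gamma_integral x.
Proof.
move=> x0; have := @gamma_integral_ge R (x + 1) 1.
rewrite lerDr ltW// => /(_ isT ltr01); rewrite addrK powR1 mul1r gamma_integralS// => H.
by rewrite -(pmulr_rgt0 _ x0) (lt_le_trans _ H)// expR_gt0.
Qed.

Lemma integral_gamma_scale {R : realType} (x a : R) : 0 < x -> 0 < a ->
  (\int[lebesgue_measure]_(u in `]0%R, +oo[)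
     (u `^ (x - 1) * expR (- (a * u)))%:E = (a `^ (- x) * gamma_integral x)%:E)%E.
Proof. by move=> x0 a0; rewrite egamma_scale// gamma_integralE. Qed.

(** Young's inequality for [y^t] and 1 with exponents [1 / t] and [1 / (1 - t)]; the endpoints,
    where one of these degenerates, are treated apart. *)
Lemma powR_le_affine {R : realType} (y t : R) : 0 <= y -> 0 <= t <= 1 ->
  y `^ t <= 1 - t + t * y.
Proof.
move=> y0 /andP[t0 t1].
have [->|t0'] := eqVneq t 0; first by rewrite powRr0 subr0 mul0r addr0.
have [->|t1'] := eqVneq t 1; first by rewrite powRr1// subrr add0r mul1r.
have {}t0 : 0 < t by rewrite lt_neqAle eq_sym t0'.
have {}t1 : t < 1 by rewrite lt_neqAle t1'.
have t1p : 0 < 1 - t by rewrite subr_gt0.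
have := @conjugate_powR R (y `^ t) 1 t^-1 (1 - t)^-1.
rewrite powR_ge0 ler01 !invr_gt0 => /(_ isT isT t0 t1p).
rewrite !invrK addrC subrK => /(_ erefl).
by rewrite mulr1 powR1 -powRrM divff ?powRr1 ?gt_eqF// mul1r addrC (mulrC y).
Qed.

(** Integrating [powR_le_affine] at [y = u / x] against [u^(x - 1) e^(-u)] gives [x^t] times
    [(1 - t) Gamma(x) + t Gamma(x + 1) / x], and the latter is [Gamma(x)]. This is the log-convexity
    needed for Bohr-Mollerup. *)
Lemma gamma_integral_le_powR {R : realType} (x t : R) : 0 < x -> 0 <= t <= 1 ->
  gamma_integral (x + t) <= x `^ t * gamma_integral x.
Proof.
move=> x0 t01; have /andP[t0 t1] := t01.
have xt0 : 0 < x + t by rewrite ltr_pwDl.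
have meas (y : R) : measurable_fun (pos R) (fun u : R => (u `^ (y - 1) * expR (- u))%:E).
  by apply/measurable_EFinP; exact: measurable_gamma_integrand.
have pge (y u : R) : (0 <= (u `^ (y - 1) * expR (- u))%:E)%E.
  by rewrite lee_fin mulr_ge0 ?powR_ge0 ?expR_ge0.
rewrite -lee_fin -gamma_integralE//.
have -> : (x `^ t * gamma_integral x)%:E = ((x `^ t * (1 - t))%:E * egamma x +
    (x `^ t * t / x)%:E * egamma (x + 1))%E.
  rewrite egammaS// muleA -EFinM divfK ?gt_eqF// -ge0_muleDl; last 2 first.
    by rewrite lee_fin mulr_ge0 ?powR_ge0 ?subr_ge0.
    by rewrite lee_fin mulr_ge0 ?powR_ge0.
  by rewrite -EFinD -mulrDr subrK mulr1 EFinM gamma_integralE.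
rewrite /egamma -!ge0_integralZl//; first last.
- by rewrite lee_fin mulr_ge0 ?powR_ge0 ?subr_ge0.
- exact: meas.
- by rewrite lee_fin !mulr_ge0 ?powR_ge0 ?invr_ge0 ?(ltW x0).
- exact: meas.
rewrite -ge0_integralD//=.
- apply: ge0_le_integral => //=.
  + exact: meas.
  + by apply: emeasurable_funD; apply: measurable_funeM; exact: meas.
  move=> u; rewrite in_itv/= andbT => u0.
  rewrite -!EFinM -EFinD lee_fin !mulrA -mulrDl ler_wpM2r ?expR_ge0//.
  have -> : u `^ (x + t - 1) = u `^ (x - 1) * (x `^ t * (u / x) `^ t).
    rewrite -powRM ?divr_ge0 ?(ltW x0) ?(ltW u0)// [x * _]mulrC divfK ?gt_eqF//.
    by rewrite -powRD ?(gt_eqF u0) ?implybT//; congr powR; ring.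
  have := @powR_le_affine R (u / x) t.
  rewrite divr_ge0 ?(ltW x0) ?(ltW u0)// => /(_ isT t01).
  have -> : x `^ t * (1 - t) * u `^ (x - 1) + x `^ t * t / x * u `^ (x + 1 - 1) =
      u `^ (x - 1) * (x `^ t * (1 - t + t * (u / x))).
    have -> : u `^ (x + 1 - 1) = u `^ (x - 1) * u.
      rewrite -[X in _ * X](powRr1 (ltW u0)) -powRD ?(gt_eqF u0) ?implybT//.
      by congr powR; ring.
    by ring.
  by move=> H; rewrite !ler_wpM2l ?powR_ge0.
- by move=> u _; rewrite mule_ge0// lee_fin mulr_ge0 ?powR_ge0 ?subr_ge0.
- by apply: measurable_funeM; exact: meas.
- by move=> u _; rewrite mule_ge0// lee_fin !mulr_ge0 ?powR_ge0 ?invr_ge0 ?(ltW x0).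
- by apply: measurable_funeM; exact: meas.
Qed.

Lemma GammaE {R : realType} (x : R) : 0 < x -> Gamma x = gamma_integral x.
Proof. by move=> x0; rewrite /Gamma x0 big_ord0 divr1 addr0. Qed.

Lemma Gamma_gt0 {R : realType} (x : R) : 0 < x -> 0 < Gamma x.
Proof. by move=> x0; rewrite GammaE// gamma_integral_gt0. Qed.

(** Written for the inverse, the functional equation holds on the whole line: at a pole both sides
    are 0. This lets Euler's limit be continued to the left without exceptions. *)
Lemma invr_GammaS {R : realType} (x : R) : (Gamma x)^-1 = x * (Gamma (x + 1))^-1.
Proof.
have [x0|x0] := ltP 0 x.
  rewrite !GammaE// ?addr_gt0// gamma_integralS// invfM mulrA divff ?mul1r//.
  exact: lt0r_neq0.
have Nx0 : 0 <= - x by rewrite oppr_ge0.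
have [x1|x1] := ltP 0 (x + 1).
  rewrite [in RHS]GammaE// /Gamma ltNge x0/=.
  have -> : Num.truncn (- x) = 0%N.
    by apply/truncn_def; rewrite mulr0n Nx0/=; lra.
  by rewrite big_ord_recl big_ord0 mulr1 addr0 invfM invrK mulrC.
rewrite /Gamma !ltNge x0 x1/=.
have -> : Num.truncn (- x) = (Num.truncn (- (x + 1))).+1.
  have xx : 0 <= - (x + 1) by rewrite oppr_ge0.
  apply/truncn_def; have := truncn_itv xx.
  rewrite opprD lerBrDr ltrBlDr !natr1 => /andP[-> H].
  by rewrite H.
set n := Num.truncn _; rewrite big_ord_recl/= addr0.
have -> : x + n.+2%:R = x + 1 + n.+1%:R by rewrite -natr1; ring.
have -> : \prod_(i < n.+1) (x + (bump 0 i)%:R) = \prod_(i < n.+1) (x + 1 + i%:R).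
  by apply: eq_bigr => i _; rewrite /bump/= add1n -natr1; ring.
by rewrite !invfM !invrK mulrCA.
Qed.

(** * Euler's limit for the inverse of the Gamma function *)

(** The inverse of Euler's [n! n^z / (z (z + 1) ... (z + n))], up to the factor [(z + n) / n], which
    tends to 1. No denominator depends on [z], so the poles of Gamma are ordinary points. *)
Definition inv_gamma_approx {R : realType} (n : nat) (z : R) : R :=
  n%:R `^ (1 - z) * \prod_(j < n) (z + j%:R) / n`!%:R.

Lemma prod_rising_shift {R : comRingType} (z : R) (n : nat) :
  z * \prod_(j < n) (z + 1 + j%:R) = (\prod_(j < n) (z + j%:R)) * (z + n%:R).
Proof.
rewrite -(big_ord_recr n (fun j => z + j%:R)) big_ord_recl/= addr0; congr (_ * _).
by apply: eq_bigr => i _; rewrite /bump/= add1n -natr1; ring.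
Qed.

Lemma inv_gamma_approxS {R : realType} (n : nat) (z : R) : (0 < n)%N ->
  z * inv_gamma_approx n (z + 1) = inv_gamma_approx n z * ((z + n%:R) / n%:R).
Proof.
move=> n0; have n0' : n%:R != 0 :> R by rewrite pnatr_eq0 -lt0n.
rewrite /inv_gamma_approx mulrCA !mulrA.
have -> : n%:R `^ (1 - (z + 1)) = n%:R `^ (1 - z) / n%:R.
  rewrite -[X in _ / X]powRr1// -powRB ?n0' ?implybT//; congr powR; ring.
transitivity (n%:R `^ (1 - z) / n%:R / n`!%:R * (z * \prod_(j < n) (z + 1 + j%:R))).
  by field; rewrite n0' pnatr_eq0 -lt0n fact_gt0.
rewrite prod_rising_shift; field.
by rewrite n0' pnatr_eq0 -lt0n fact_gt0.
Qed.

Lemma cvg_ratio_shift {R : realType} (z : R) : n%:R / (z + n%:R) @[n --> \oo] --> (1 : R).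
Proof.
have H : (z + n%:R) / n%:R @[n --> \oo] --> (1 : R).
  have H : z * (n%:R)^-1 + 1 @[n --> \oo] --> (1 : R).
    rewrite -[X in _ --> X]add0r -[X in _ --> X + _](mulr0 z).
    apply: cvgD; last exact: cvg_cst.
    apply: cvgMr; apply/(@gtr0_cvgV0 R _ _ _ (fun n => n%:R)); last exact: cvgr_idn.
    by near=> n; rewrite ltr0n; near: n; exists 1%N.
  apply: cvg_trans H; apply: near_eq_cvg; near=> n.
  rewrite mulrDl divff// pnatr_eq0 -lt0n; near: n; by exists 1%N.
have : ((z + n%:R) / n%:R)^-1 @[n --> \oo] --> (1 : R).
  by rewrite -[X in _ --> X]invr1; exact: (cvgV (@oner_neq0 R) H).
by under eq_fun do rewrite invf_div.
Unshelve. all: by end_near. Qed.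

(* Bohr-Mollerup: the last hypothesis on [g] is a form of log-convexity. *)
Lemma bohr_mollerup_cvg {R : realType} (g : R -> R) :
  (forall x, 0 < x -> 0 < g x) -> g 1 = 1 ->
  (forall x, 0 < x -> g (x + 1) = x * g x) ->
  (forall x t, 0 < x -> 0 <= t <= 1 -> g (x + t) <= x `^ t * g x) ->
  forall z, 0 < z <= 1 -> inv_gamma_approx n z @[n --> \oo] --> (g z)^-1.
Proof.
move=> g0 g1 gS gle z /andP[z0 z1]; have gz := g0 _ z0.
have gn n : (0 < n)%N -> n%:R * g n%:R = n`!%:R.
  move=> n0; rewrite -gS ?ltr0n// natr1; elim: n {n0} => [|n IH]; first by rewrite g1.
  by rewrite -natr1 gS ?ltr0n// IH factS natrM.
have gprod n : g (z + n%:R) = \prod_(j < n) (z + j%:R) * g z.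
  elim: n => [|n IH]; first by rewrite big_ord0 mul1r addr0.
  by rewrite -natr1 addrA gS ?ltr_wpDr// IH big_ord_recr/=; ring.
(* The convexity bound is used twice: from [n] with increment [z] for the upper estimate, and from
   [z + n] with increment [1 - z], ending at [n + 1], for the lower one. *)
have key n : (0 < n)%N -> n%:R / (z + n%:R) <= inv_gamma_approx n z * g z <= 1.
  move=> n0; have n0' : 0 < n%:R :> R by rewrite ltr0n.
  have nz : 0 < z + n%:R by rewrite addr_gt0.
  have -> : inv_gamma_approx n z * g z = n%:R `^ (1 - z) * g (z + n%:R) / n`!%:R.
    by rewrite gprod /inv_gamma_approx; ring.
  have f0 : 0 < n`!%:R :> R by rewrite ltr0n fact_gt0.
  apply/andP; split; last first.
    rewrite ler_pdivrMr// mul1r -(gn _ n0) [z + _]addrC.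
    have := gle n%:R z n0'; rewrite (ltW z0) z1 => /(_ isT) H.
    apply: le_trans (ler_wpM2l (powR_ge0 n%:R (1 - z)) H) _.
    by rewrite mulrA -powRD ?(gt_eqF n0') ?implybT// subrK powRr1// ltW.
  rewrite ler_pdivlMr// -(gn _ n0) -gS//.
  have := gle (z + n%:R) (1 - z) nz.
  have -> : z + n%:R + (1 - z) = n%:R + 1 by ring.
  rewrite subr_ge0 z1 lerBlDr lerDl (ltW z0) => /(_ isT) H.
  apply: le_trans (ler_wpM2l _ H) _; first by rewrite divr_ge0// ltW.
  rewrite mulrA ler_wpM2r//; first by rewrite ltW// g0.
  have -> : n%:R `^ (1 - z) = (n%:R / (z + n%:R)) `^ (1 - z) * (z + n%:R) `^ (1 - z).
    by rewrite -powRM ?divr_ge0 ?(ltW nz)// divfK// gt_eqF.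
  rewrite ler_wpM2r ?powR_ge0// ger1_powR ?lerBlDr ?lerDl ?(ltW z0)//.
  by rewrite divr_gt0//= ler_pdivrMr// mul1r lerDr ltW.
have : inv_gamma_approx n z * g z @[n --> \oo] --> (1 : R).
  apply: (@squeeze_cvgr _ _ _ _ (fun n => n%:R / (z + n%:R)) (fun=> 1)).
  - by near=> n; apply: key; near: n; exists 1%N.
  - exact: cvg_ratio_shift.
  - exact: cvg_cst.
move=> H.
have : inv_gamma_approx n z * g z / g z @[n --> \oo] --> 1 / g z by exact: cvgMl.
rewrite mul1r.
by under eq_fun do rewrite mulfK ?gt_eqF//.
Unshelve. all: by end_near. Qed.

(** Bohr-Mollerup settles []0, 1]], and the functional equations of the approximants and of
    [1 / Gamma] carry the limit by unit steps. Going down multiplies by [y] and is always allowed;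
    going up divides by [y], whence [0 < y]. *)
Lemma inv_gamma_approx_cvg {R : realType} (z : R) :
  inv_gamma_approx n z @[n --> \oo] --> (Gamma z)^-1.
Proof.
have down (y : R) : inv_gamma_approx n (y + 1) @[n --> \oo] --> (Gamma (y + 1))^-1 ->
    inv_gamma_approx n y @[n --> \oo] --> (Gamma y)^-1.
  move=> H; rewrite invr_GammaS -[_ * _]mulr1.
  have : y * inv_gamma_approx n (y + 1) * (n%:R / (y + n%:R)) @[n --> \oo] -->
    y * (Gamma (y + 1))^-1 * 1 by apply: cvgM; [exact: cvgMr|exact: cvg_ratio_shift].
  apply: cvg_trans; apply: near_eq_cvg; near=> n.
  have n0 : (0 < n)%N by near: n; exists 1%N.
  have yn : 0 < y + n%:R.
    by rewrite addrC -[y]opprK subr_gt0; near: n; exact: nbhs_infty_gtr.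
  rewrite inv_gamma_approxS// -mulrA mulrA; field.
  by rewrite gt_eqF//= pnatr_eq0 -lt0n.
have up (y : R) : 0 < y -> inv_gamma_approx n y @[n --> \oo] --> (Gamma y)^-1 ->
    inv_gamma_approx n (y + 1) @[n --> \oo] --> (Gamma (y + 1))^-1.
  move=> y0 H.
  have -> : (Gamma (y + 1))^-1 = y^-1 * (Gamma y)^-1 * 1^-1.
    by rewrite [in RHS]invr_GammaS mulrA mulVf ?mul1r ?invr1 ?mulr1// gt_eqF.
  have : y^-1 * inv_gamma_approx n y * (n%:R / (y + n%:R))^-1 @[n --> \oo] -->
    y^-1 * (Gamma y)^-1 * 1^-1.
    by apply: cvgM; [exact: cvgMr|apply: cvgV (@oner_neq0 R) _; exact: cvg_ratio_shift].
  apply: cvg_trans; apply: near_eq_cvg; near=> n.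
  have n0 : (0 < n)%N by near: n; exists 1%N.
  rewrite invf_div -mulrA -inv_gamma_approxS// mulrA mulVf ?mul1r//.
  exact: lt0r_neq0.
(* The induction enlarges the interval []-m, m + 1]] by one unit on each side. *)
suff H (m : nat) : forall z : R, - m%:R < z <= m%:R + 1 ->
    inv_gamma_approx n z @[n --> \oo] --> (Gamma z)^-1.
  pose m := (Num.truncn `|z|).+1.
  have zm : `|z| < m%:R by rewrite /m truncnS_gt.
  apply: (H m); move: zm; rewrite ltr_norml => /andP[-> zm]/=.
  by rewrite ltW// (lt_trans zm)// ltrDl.
elim: m => [|m IH] {}z.
  rewrite oppr0 add0r => z01; have /andP[z0 _] := z01; rewrite GammaE//.
  apply: bohr_mollerup_cvg z01.
  - exact: gamma_integral_gt0.
  - exact: (@gamma_integral_nat R 0).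
  - exact: gamma_integralS.
  - exact: gamma_integral_le_powR.
move=> /andP[z1 z2].
have [zm|zm] := ltP (m%:R + 1) z.
  rewrite -[z](subrK 1); apply: up.
    by rewrite subr_gt0 (le_lt_trans _ zm)// lerDr.
  have m0 := ler0n R m; move: z2 zm; rewrite -[m.+1%:R]natr1 => z2 zm.
  by apply: IH; lra.
have [zm'|zm'] := ltP (- m%:R) z; first by apply: IH; rewrite zm' zm.
apply: down; apply: IH; apply/andP; split.
  by move: z1; rewrite -natr1 opprD ltrBlDr.
by rewrite lerD2r (le_trans zm')// (@le_trans _ _ 0) ?oppr_le0.
Unshelve. all: by end_near. Qed.

(** * The density of the random time *)

(* With [x = s p^a],
   [(- d/dp)^n (p^(a-1) e^(-x)) = p^(a-1-n) e^(-x) \sum_k c_{n,k} x^k]. *)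
Fixpoint wright_coef {R : realType} (a : R) (n k : nat) : R :=
  if n is n'.+1 then
    (n%:R - a * k.+1%:R) * wright_coef a n' k +
    (if k is k'.+1 then a * wright_coef a n' k' else 0)
  else (k == 0%N)%:R.

Lemma wright_coef_gt {R : realType} (a : R) n k : (n < k)%N -> wright_coef a n k = 0.
Proof.
elim: n k => [|n IH] [|k]//= nk; rewrite IH ?mulr0 ?add0r; last exact: ltnW.
by rewrite IH// mulr0.
Qed.

(** Positivity of the density originates here: for [k <= n] the factor [n + 1 - a (k + 1)] is
    nonnegative because [a <= 1], and for [k > n] the coefficient it multiplies is 0. *)
Lemma wright_coef_ge0 {R : realType} (a : R) n k : 0 <= a <= 1 -> 0 <= wright_coef a n k.
Proof.
move=> /andP[a0 a1]; elim: n k => [|n IH] k; first exact: ler0n.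
rewrite /=; apply: addr_ge0; last by case: k => // k; rewrite mulr_ge0.
have [kn|kn] := leqP k n; last by rewrite wright_coef_gt// mulr0.
rewrite mulr_ge0// subr_ge0 (@le_trans _ _ k.+1%:R)// ?ler_nat//.
by rewrite ler_piMl.
Qed.

(* At [x = - r] the identity gives the Taylor coefficients of
   [e^(-y) \sum_k c_{n,k} y^k]; at [x = d + 1] its moments. *)
Lemma sum_wright_coef {R : realType} (a x : R) n :
  \sum_(k < n.+1) wright_coef a n k * \prod_(i < k) (x + i%:R) =
  \prod_(j < n) (1 + a * (x - 1) + j%:R).
Proof.
elim: n => [|n IH]; first by rewrite big_ord_recl !big_ord0 /= mulr1 addr0.
rewrite [RHS]big_ord_recr -IH/= mulr_suml.
pose P k := \prod_(i < k) (x + i%:R).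
rewrite (eq_bigr (fun k : 'I_n.+2 => (n.+1%:R - a * k.+1%:R) * wright_coef a n k * P k +
  (if (k : nat) is k'.+1 then a * wright_coef a n k' else 0) * P k)); last first.
  by move=> k _; rewrite -mulrDl.
rewrite big_split/= big_ord_recr/= wright_coef_gt// mulr0 mul0r addr0.
rewrite [X in _ + X]big_ord_recl/= mul0r add0r -big_split/=.
apply: eq_bigr => k _; rewrite /bump/= add1n -/(P k).
have -> : P k.+1 = P k * (x + k%:R) by rewrite /P big_ord_recr.
by rewrite -!natr1; ring.
Qed.

(** The product is [(-1)^k r (r - 1) ... (r - k + 1)], so this is the exponential series
    differentiated [k] times. In the induction the term [r = 0] vanishes and the index is shifted by
    one. *)
Lemma cvg_series_expR_pow {R : realType} (x : R) k :
  series (fun r : nat => (- x) ^+ r / r`!%:R * \prod_(i < k) (- r%:R + i%:R)) n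
    @[n --> \oo] --> x ^+ k * expR (- x).
Proof.
elim: k => [|k IH].
  rewrite expr0 mul1r [X in series X](_ : _ = exp_coeff (- x)); last first.
    by apply/funext => r; rewrite big_ord0 mulr1.
  exact: is_cvg_series_exp_coeff.
rewrite -[X in X --> _]/(series _ @ \oo) -cvg_shiftS.
have -> : x ^+ k.+1 * expR (- x) = x * (x ^+ k * expR (- x)) by rewrite exprS mulrA.
pose v (r : nat) : R := (- x) ^+ r / r`!%:R * \prod_(i < k) (- r%:R + i%:R).
have H : x * series v n @[n --> \oo] --> x * (x ^+ k * expR (- x)) by exact: cvgMr.
apply: cvg_trans H; apply: near_eq_cvg; near=> n.
rewrite /series/= big_nat_recl// [X in _ = X + _](_ : _ = 0) ?add0r; last first.
  by rewrite big_ord_recl/= oppr0 addr0 mul0r mulr0.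
rewrite mulr_sumr; apply: eq_bigr => r _; rewrite /v.
rewrite [in RHS]big_ord_recl/= addr0 factS natrM exprS.
have -> : \prod_(i < k) (- r.+1%:R + (bump 0 i)%:R) = \prod_(i < k) (- r%:R + i%:R) :> R.
  by apply: eq_bigr => i _; rewrite /bump/= add1n -!natr1; ring.
field; rewrite nat1r !pnatr_eq0/= -lt0n fact_gt0.
Unshelve. all: by end_near. Qed.

(** * Limits of series under a summable majorant *)

Lemma cvg_bigsum {R : realType} {T : Type} {F : set_system T} {FF : Filter F}
    {I : Type} (s : seq I) (f : I -> T -> R) (l : I -> R) :
  (forall i, f i x @[x --> F] --> l i) ->
  \sum_(i <- s) f i x @[x --> F] --> \sum_(i <- s) l i.
Proof.
move=> fl; elim: s => [|i s IH].
  by rewrite big_nil; under eq_fun do rewrite big_nil; exact: cvg_cst.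
rewrite big_cons; under eq_fun do rewrite big_cons.
by apply: cvgD; [exact: fl|exact: IH].
Qed.

Lemma series_le_cvg_norm {R : realType} (u B : nat -> R) :
  (forall r, `|u r| <= B r) -> cvgn (series B) -> cvgn (series u).
Proof.
move=> uB cB; apply: normed_cvg.
apply: series_le_cvg cB => r //=; exact: le_trans (uB r).
Qed.

Lemma lim_series_tail {R : realType} (u B : nat -> R) N :
  (forall r, `|u r| <= B r) -> cvgn (series B) ->
  `|limn (series u) - series u N| <= limn (series B) - series B N.
Proof.
move=> uB cB; have cu := series_le_cvg_norm uB cB.
have H1 : `|series u n - series u N| @[n --> \oo] --> `|limn (series u) - series u N|.
  by apply: cvg_norm; apply: cvgB => //; exact: cvg_cst.
have H2 : series B n - series B N @[n --> \oo] --> limn (series B) - series B N.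
  by apply: cvgB => //; exact: cvg_cst.
rewrite -(cvg_lim _ H1)// -(cvg_lim _ H2)//; apply: ler_lim.
- by apply/cvg_ex; eexists; exact: H1.
- by apply/cvg_ex; eexists; exact: H2.
near=> n; have Nn : (N <= n)%N by near: n; exists N.
rewrite !sub_series_geq//; apply: le_trans (ler_norm_sum _ _ _) _.
by apply: ler_sum.
Unshelve. all: by end_near. Qed.

Lemma norm_lim_series_le {R : realType} (u B : nat -> R) :
  (forall r, `|u r| <= B r) -> cvgn (series B) ->
  `|limn (series u)| <= limn (series B).
Proof.
move=> uB cB; have := lim_series_tail 0 uB cB.
by rewrite /series/= !big_geq// !subr0.
Qed.

Lemma tannery {R : realType} (u : nat -> nat -> R) (v B : nat -> R) :
  (forall n r, `|u n r| <= B r) -> cvgn (series B) ->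
  (forall r, u n r @[n --> \oo] --> v r) ->
  limn (series (u n)) @[n --> \oo] --> limn (series v).
Proof.
move=> uB cB uv.
have vB r : `|v r| <= B r.
  have H : `|u n r| @[n --> \oo] --> `|v r| by apply: cvg_norm; exact: uv.
  rewrite -(cvg_lim _ H)//; apply: limr_le; first by apply/cvg_ex; eexists; exact: H.
  by near=> n.
apply/cvgrPdist_le => e e0.
have e3 : 0 < e / 3 by rewrite divr_gt0.
have [N _ HN] : \forall N \near \oo, `|limn (series B) - series B N| <= e / 3.
  by move: cB => /cvgrPdist_le; apply.
have {}HN : limn (series B) - series B N <= e / 3.
  exact: le_trans (ler_norm _) (HN N (leqnn N)).
have sN : series (u n) N @[n --> \oo] --> series v N.
  exact: cvg_bigsum.
near=> n.
have -> : limn (series v) - limn (series (u n)) = (limn (series v) - series v N) +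
   (series v N - series (u n) N) - (limn (series (u n)) - series (u n) N) by ring.
rewrite (le_trans (ler_normB _ _))// (le_trans (lerD (ler_normD _ _) (lexx _)))//.
have H1 := lim_series_tail N vB cB.
have H2 := lim_series_tail N (uB n) cB.
have H3 : `|series v N - series (u n) N| <= e / 3.
  by near: n; move: sN => /cvgrPdist_le; apply.
lra.
Unshelve. all: by end_near. Qed.

(** * Bounds uniform in the order of approximation *)

Lemma pow_fact_le_expR {R : realType} (w : R) n : 0 <= w -> w ^+ n / n`!%:R <= expR w.
Proof.
move=> w0; case: n => [|n].
  by rewrite expr0 divr1 -[leLHS]addr0 (le_trans _ (expR_ge1Dx w))// lerD2l.
by apply: le_trans (expR_ge1Dxn n w0); rewrite lerDr.
Qed.

(** [Q] does not increase once [m + 1 >= w], since [(1 + 1/(m+1))^w (1 - w/(m+1))] is at most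
    [e^(w/(m+1)) e^(-w/(m+1)) = 1]. Before that, every factor is at most [w] in absolute value and
    [m + 2 <= 1 + w], so [w^(m+1) / (m+1)! <= e^w] gives the bound directly. *)
Lemma inv_gamma_approx_bound {R : realType} (w : R) n : 0 <= w ->
  `|inv_gamma_approx n (1 - w)| <= expR w * (1 + w) `^ w.
Proof.
move=> w0.
pose Q n := n.+1%:R `^ w * \prod_(j < n) `|1 - w + j%:R| / n`!%:R.
have QB m : Q m <= expR w * (1 + w) `^ w.
  elim: m => [|m IH].
    rewrite /Q big_ord0 powR1 mulr1 divr1 -[leLHS]mulr1 ler_pM//.
      by rewrite -expR0 ler_expR.
    by rewrite -[leLHS](powRr0 (1 + w)) ler_powR// lerDl.
  have [wm|mw] := leP w m.+1%:R.
    apply: le_trans IH; rewrite /Q big_ord_recr/= factS natrM.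
    have m0 : 0 < m.+1%:R :> R by rewrite ltr0n.
    have E : m.+2%:R `^ w * `|1 - w + m%:R| / m.+1%:R <= m.+1%:R `^ w.
      have -> : m.+2%:R = m.+1%:R * (1 + m.+1%:R^-1) :> R.
        by rewrite mulrDr mulr1 divff ?gt_eqF// natr1.
      rewrite powRM ?(ltW m0)//.
      rewrite -mulrA -mulrA -[leRHS]mulr1 ler_wpM2l ?powR_ge0//.
      have -> : 1 - w + m%:R = m.+1%:R - w by rewrite -natr1; ring.
      rewrite ger0_norm ?subr_ge0// mulrBl divff ?gt_eqF//.
      apply: (@le_trans _ _ (expR (w / m.+1%:R) * expR (- (w / m.+1%:R)))); last first.
        by rewrite -expRD subrr expR0.
      rewrite ler_pM ?powR_ge0 ?subr_ge0 ?ler_pdivrMr ?mul1r//.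
        rewrite -[w / _]mulrC expRM ge0_ler_powR// ?nnegrE ?expR_ge0// ?expR_ge1Dx//.
      exact: expR_ge1Dx.
    have F0 : 0 <= \prod_(j < m) `|1 - w + j%:R| / m`!%:R.
      by rewrite divr_ge0// prodr_ge0.
    have -> : m.+2%:R `^ w * (\prod_(i < m) `|1 - w + i%:R| * `|1 - w + m%:R|) /
       (m.+1%:R * m`!%:R) = (m.+2%:R `^ w * `|1 - w + m%:R| / m.+1%:R) *
       (\prod_(j < m) `|1 - w + j%:R| / m`!%:R).
      by field; rewrite pnatr_eq0 -lt0n fact_gt0/= nat1r pnatr_eq0.
    by rewrite -[leRHS]mulrA ler_wpM2r.
  rewrite /Q mulrAC -mulrA mulrC; apply: ler_pM; rewrite ?powR_ge0 ?mulr_ge0 ?invr_ge0 ?prodr_ge0//.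
    rewrite mulrC; apply: le_trans (pow_fact_le_expR m.+1 w0).
    rewrite ler_wpM2r ?invr_ge0//.
    rewrite -[m.+1 in leRHS]card_ord -prodr_const; apply: ler_prod => j _.
    rewrite normr_ge0/= ler_norml; have jm : j%:R <= m%:R :> R by rewrite ler_nat -ltnS.
    move: mw; rewrite -natr1 => mw; have j0 := ler0n R j; lra.
  rewrite ge0_ler_powR// ?nnegrE ?ler0n ?(addr_ge0 ler01 w0)//.
  by rewrite -natr1 addrC lerD2l ltW.
apply: le_trans (QB n); rewrite /inv_gamma_approx /Q !normrM normr_prod.
rewrite ger0_norm ?powR_ge0// [X in _ * X <= _]ger0_norm ?invr_ge0//.
rewrite !ler_wpM2r ?invr_ge0 ?prodr_ge0//.
have -> : 1 - (1 - w) = w by ring.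
by rewrite ge0_ler_powR// ?nnegrE// ler_nat.
Qed.

Lemma cvg_series_geometric_bound {R : realType} (f : nat -> R) (M p C : R) :
  0 < M -> 0 < p ->
  (forall r, 0 <= f r <= C * (M / r.+2%:R `^ p) ^+ r) -> cvgn (series f).
Proof.
move=> M0 p0 fb.
(* From [r0] on, [r.+2^p >= 2 M] and the base of the power is at most 1/2. For smaller [r] the power
   is at most [M'^r 2^(-r)]; as [M' >= 1], the constant [M'^r0] serves all indices. *)
pose r0 := (Num.truncn ((2 * M) `^ p^-1)).+1.
pose M' := Num.max (2 * M) 1.
have C0 : 0 <= C.
  have /andP[f0 ] := fb 0%N; rewrite expr0 mulr1; exact: le_trans.
have key r : (M / r.+2%:R `^ p) ^+ r <= M' ^+ r0 * 2^-1 ^+ r.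
  have rp : 0 < r.+2%:R `^ p :> R by rewrite powR_gt0.
  have M'1 : 1 <= M' by rewrite le_max lexx orbT.
  have [rr|rr] := leqP r0 r.
    rewrite -[leLHS]mul1r ler_pM//; first by rewrite exprn_ge0// divr_ge0// ltW.
      by rewrite exprn_ege1.
    rewrite lerXn2r ?nnegrE ?divr_ge0 ?(ltW M0) ?(ltW rp)//.
    rewrite ler_pdivrMr// mulrC ler_pdivlMr// mulrC.
    have H : (2 * M) `^ p^-1 <= r.+2%:R.
      rewrite (le_trans (ltW (truncnS_gt _)))// ler_nat -/r0.
      by rewrite (leq_trans rr)// (leq_trans (leqnSn _)).
    have := ge0_ler_powR (ltW p0) _ _ H; rewrite !nnegrE powR_ge0 ler0n => /(_ isT isT).
    by rewrite -powRrM mulVf ?gt_eqF// powRr1// mulr_ge0// ltW.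
  rewrite -[M / _](_ : 2 * M / r.+2%:R `^ p * 2^-1 = _); last by field; rewrite gt_eqF.
  rewrite exprMn ler_wpM2r ?exprn_ge0//.
  apply: (@le_trans _ _ (M' ^+ r)); last by rewrite ler_weXn2l// ltnW.
  rewrite lerXn2r ?nnegrE ?divr_ge0 ?mulr_ge0 ?(ltW M0) ?(ltW rp) ?(le_trans ler01 M'1)//.
  rewrite ler_pdivrMr// (@le_trans _ _ M')//; first by rewrite le_max lexx.
  rewrite ler_peMr ?(le_trans ler01 M'1)//.
  by rewrite -[leLHS](powRr0 r.+2%:R) ler_powR ?ler1n// ltW.
apply: (@series_le_cvg _ _ (geometric (C * M' ^+ r0) 2^-1)) => [r|r|r|].
- by have /andP[] := fb r.
- by rewrite /= !mulr_ge0 ?exprn_ge0// le_max ler01 orbT.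
- have /andP[_ /le_trans] := fb r; apply.
  by rewrite /= -mulrA ler_wpM2l.
apply: is_cvg_geometric_series.
by rewrite ger0_norm// invf_lt1// ltr1n.
Qed.

(** The lower bound for Gamma at [A = r + 2]; this [A] matches the base [r.+2] of
    [cvg_series_geometric_bound]. *)
Lemma fact_ge_pow {R : realType} r : r.+2%:R ^+ r * expR (- r.+3%:R) <= r`!%:R :> R.
Proof.
have := @gamma_integral_ge R r.+1%:R r.+2%:R.
rewrite ler1n ltr0n => /(_ isT isT).
rewrite gamma_integral_nat natr1.
have -> : r.+1%:R - 1 = r%:R :> R by rewrite -natr1 addrK.
by rewrite powR_mulrn.
Qed.

(** With [N = r + 2], the factorial contributes [N^(-r)] and the Gamma bound [N^(a r)], up to
    geometric factors; the stray [N^a] is at most [N <= 2^(r+2)]. What remains is the [r]-th power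
    of a constant over [N^(1 - a)], and [a < 1] makes it summable. *)
Lemma cvg_series_wright_bound {R : realType} (a K : R) : 0 < a < 1 -> 0 < K ->
  cvgn (series (fun r : nat => K ^+ r / r`!%:R *
    (expR (a * r.+1%:R) * (1 + a * r.+1%:R) `^ (a * r.+1%:R)))).
Proof.
move=> /andP[a0 a1] K0.
apply: (@cvg_series_geometric_bound _ _ (2 * K * expR (a + 1)) (1 - a) (2 * expR (a + 3) * 2 )).
- by rewrite !mulr_gt0 ?expR_gt0.
- by rewrite subr_gt0.
move=> r; apply/andP; split.
  by rewrite !mulr_ge0 ?exprn_ge0 ?invr_ge0 ?expR_ge0 ?powR_ge0// ltW.
set N : R := r.+2%:R.
have N0 : 0 < N by rewrite ltr0n.
have f0 : 0 < r`!%:R :> R by rewrite ltr0n fact_gt0.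
have H1 : (1 + a * r.+1%:R) `^ (a * r.+1%:R) <= N `^ (a * r.+1%:R).
  have ar : 0 <= a * r.+1%:R by rewrite mulr_ge0 ?ler0n ?(ltW a0).
  rewrite ge0_ler_powR ?nnegrE ?ar ?(ltW N0) ?(addr_ge0 ler01 ar)//.
  by rewrite /N -[r.+2%:R]natr1 [leRHS]addrC lerD2l ler_piMl ?ler0n// ltW.
have H2 : r`!%:R^-1 <= expR r.+3%:R / N ^+ r.
  rewrite -[leRHS]invrK lef_pV2 ?posrE ?invr_gt0 ?divr_gt0 ?expR_gt0 ?exprn_gt0//.
  by rewrite invf_div -expRN; exact: fact_ge_pow.
have H3 : N `^ (a * r.+1%:R) <= 2 ^+ r.+2 * (N `^ a) ^+ r.
  have -> : a * r.+1%:R = a + a * r%:R by rewrite -natr1; ring.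
  rewrite powRD; last by rewrite (gt_eqF N0) implybT.
  rewrite powRrM powR_mulrn ?powR_ge0// ler_wpM2r ?exprn_ge0 ?powR_ge0//.
  apply: (@le_trans _ _ N).
    by rewrite ler1_powR ?ler1n// ltW.
  by rewrite /N -natrX ler_nat; apply: ltnW; exact: ltn_expl.
have H4 : K ^+ r / r`!%:R * (expR (a * r.+1%:R) * (1 + a * r.+1%:R) `^ (a * r.+1%:R))
   <= K ^+ r * (expR r.+3%:R / N ^+ r) * (expR (a * r.+1%:R) * (2 ^+ r.+2 * (N `^ a) ^+ r)).
  apply: ler_pM.
  - by rewrite mulr_ge0 ?exprn_ge0 ?invr_ge0// ltW.
  - by rewrite mulr_ge0 ?expR_ge0 ?powR_ge0.
  - by rewrite ler_wpM2l// exprn_ge0// ltW.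
  - by rewrite ler_wpM2l ?expR_ge0// (le_trans H1).
apply: le_trans H4 _.
have -> : expR r.+3%:R = expR 3 * expR 1 ^+ r :> R.
  by rewrite -expRM_natl -expRD; congr expR; rewrite mulr1 -[r.+3]addn3 natrD addrC.
have -> : expR (a * r.+1%:R) = expR a * expR a ^+ r :> R.
  by rewrite -expRM_natl -expRD; congr expR; rewrite -natr1; ring.
have -> : N `^ (1 - a) = N / N `^ a.
  by rewrite powRB ?powRr1 ?(ltW N0)// (gt_eqF N0) implybT.
have Na : N `^ a != 0 by rewrite gt_eqF// powR_gt0.
rewrite !expRD !exprMn !exprS invf_div !exprMn.
by rewrite !exprVn le_eqVlt; apply/orP; left; apply/eqP; field; rewrite expf_neq0// gt_eqF.
Qed.

(* Post-Widder inversion at [p = n / t], where [c = t^a], so that [y = p^a]. *)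
Definition wright_approx {R : realType} (a c : R) (n : nat) (s : R) : R :=
  let y := n%:R `^ a / c in
  y / n`!%:R * (expR (- (y * s)) * \sum_(k < n.+1) wright_coef a n k * (y * s) ^+ k).

Definition wright_bound {R : realType} (a K : R) (r : nat) : R :=
  K ^+ r / r`!%:R * (expR (a * r.+1%:R) * (1 + a * r.+1%:R) `^ (a * r.+1%:R)).

Lemma wright_approx_ge0 {R : realType} (a c : R) n s : 0 <= a <= 1 -> 0 < c ->
  0 <= s -> 0 <= wright_approx a c n s.
Proof.
move=> a01 c0 s0; rewrite /wright_approx.
have y0 : 0 <= n%:R `^ a / c by rewrite divr_ge0 ?powR_ge0// ltW.
apply: mulr_ge0; first by rewrite mulr_ge0 ?invr_ge0.
apply: mulr_ge0; first exact: expR_ge0.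
apply: sumr_ge0 => k _.
by rewrite mulr_ge0 ?wright_coef_ge0// exprn_ge0// mulr_ge0.
Qed.

Lemma measurable_wright_approx {R : realType} (a c : R) n (D : set R) :
  measurable_fun D (wright_approx a c n).
Proof.
apply: measurable_funM; first exact: measurable_cst.
apply: measurable_funM.
  by apply: measurableT_comp => //; apply: measurableT_comp.
apply: measurable_sum => k; apply: measurable_funM; first exact: measurable_cst.
by apply: measurable_funX.
Qed.

(** Each [x^k e^(-x)] is expanded by [cvg_series_expR_pow], and [sum_wright_coef] at [- r] collapses
    the sum over [k]. The [r + 1] factors [n^a], one of them from the prefactor [y], are exactly the
    normalisation [n^(1 - z)] at [z = 1 - a (r + 1)]. *)
Lemma wright_approxE {R : realType} (a c : R) n s : 0 < a -> 0 < c ->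
  cvgn (series (fun r => (- (s / c)) ^+ r / r`!%:R *
     inv_gamma_approx n (1 - a * r.+1%:R))) ->
  wright_approx a c n s = c^-1 *
  limn (series (fun r => (- (s / c)) ^+ r / r`!%:R *
     inv_gamma_approx n (1 - a * r.+1%:R))).
Proof.
move=> a0 c0 cu; set y := n%:R `^ a / c.
pose x := y * s.
pose v k (r : nat) : R := (- x) ^+ r / r`!%:R * \prod_(i < k) (- r%:R + i%:R).
have H : \sum_(k < n.+1) wright_coef a n k * series (v k) m @[m --> \oo] -->
   \sum_(k < n.+1) wright_coef a n k * (x ^+ k * expR (- x)).
  by apply: cvg_bigsum => k; apply: cvgMr; exact: cvg_series_expR_pow.
have E m : \sum_(k < n.+1) wright_coef a n k * series (v k) m =
   series (fun r : nat => (- x) ^+ r / r`!%:R * \prod_(j < n) (1 - a * r.+1%:R + j%:R)) m.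
  rewrite /series/=; under eq_bigr do rewrite mulr_sumr.
  rewrite exchange_big/=; apply: eq_bigr => r _.
  rewrite /v (_ : \prod_(j < n) _ = \prod_(j < n) (1 + a * (- r%:R - 1) + j%:R)).
    by rewrite -sum_wright_coef mulr_sumr; apply: eq_bigr => k _; rewrite mulrCA.
  by apply: eq_bigr => j _; rewrite -natr1; ring.
have {}H : series (fun r : nat => (- x) ^+ r / r`!%:R *
    \prod_(j < n) (1 - a * r.+1%:R + j%:R)) m @[m --> \oo] -->
    \sum_(k < n.+1) wright_coef a n k * (x ^+ k * expR (- x)).
  by under eq_fun do rewrite -E.
rewrite /wright_approx -/y -/x.
have -> : expR (- x) * (\sum_(k < n.+1) wright_coef a n k * x ^+ k) =
   \sum_(k < n.+1) wright_coef a n k * (x ^+ k * expR (- x)).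
  by rewrite mulr_sumr; apply: eq_bigr => k _; rewrite mulrC mulrA.
rewrite -(cvg_lim _ H)//.
have H1 : y / n`!%:R * series (fun r : nat => (- x) ^+ r / r`!%:R *
    \prod_(j < n) (1 - a * r.+1%:R + j%:R)) m @[m --> \oo] -->
   y / n`!%:R * limn (series (fun r : nat => (- x) ^+ r / r`!%:R *
    \prod_(j < n) (1 - a * r.+1%:R + j%:R))).
  by apply: cvgMr; apply/cvg_ex; eexists; exact: H.
have H2 : c^-1 * series (fun r => (- (s / c)) ^+ r / r`!%:R *
     inv_gamma_approx n (1 - a * r.+1%:R)) m @[m --> \oo] -->
  c^-1 * limn (series (fun r => (- (s / c)) ^+ r / r`!%:R *
     inv_gamma_approx n (1 - a * r.+1%:R))) by exact: cvgMr.
rewrite -(cvg_lim _ H1)// -(cvg_lim _ H2)//; congr (limn _); apply/funext => m.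
rewrite /series/= !mulr_sumr; apply: eq_bigr => r _.
rewrite /inv_gamma_approx.
have -> : n%:R `^ (1 - (1 - a * r.+1%:R)) = (n%:R `^ a) ^+ r.+1.
  rewrite -powR_mulrn ?powR_ge0// -powRrM; congr powR; ring.
have -> : - x = n%:R `^ a * - (s / c) by rewrite /x /y; ring.
rewrite exprMn exprS /y.
move: (n%:R `^ a) (\prod_(j < n) _) (- (s / c)) => A B t; ring.
Qed.

Lemma wright_term_bound {R : realType} (a x K : R) n r : 0 <= a -> `|x| <= K ->
  `|x ^+ r / r`!%:R * inv_gamma_approx n (1 - a * r.+1%:R)| <= wright_bound a K r.
Proof.
move=> a0 xK; rewrite normrM ler_pM//; last first.
  by apply: inv_gamma_approx_bound; rewrite mulr_ge0.
rewrite normrM normrX [X in _ * X]ger0_norm ?invr_ge0// ler_wpM2r ?invr_ge0//.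
by rewrite lerXn2r ?nnegrE// (le_trans _ xK).
Qed.

(** Termwise convergence is Euler's limit, and [wright_bound] is a majorant independent of [n].
    Poles among the [1 - a (r + 1)] need no separate treatment. *)
Lemma cvg_wright_approx {R : realType} (a c s : R) : 0 < a < 1 -> 0 < c ->
  wright_approx a c n s @[n --> \oo] --> c^-1 * wright (- a) (1 - a) (- (s / c)).
Proof.
move=> a01 c0; have /andP[a0 a1] := a01.
set x := - (s / c); pose K := `|x| + 1.
have K0 : 0 < K by rewrite ltr_wpDl.
have xK : `|x| <= K by rewrite lerDl.
have cB := cvg_series_wright_bound a01 K0.
have -> : wright_approx a c ^~ s = (fun n => c^-1 * limn (series (fun r =>
   x ^+ r / r`!%:R * inv_gamma_approx n (1 - a * r.+1%:R)))).
  apply/funext => n; apply: wright_approxE => //.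
  apply: series_le_cvg_norm cB => r; apply: wright_term_bound => //; exact: ltW.
apply: cvgMr; rewrite /wright.
rewrite (_ : (fun r : nat => x ^+ r / (r`!%:R * Gamma (- a * r%:R + (1 - a)))) =
   (fun r : nat => x ^+ r / r`!%:R * (Gamma (1 - a * r.+1%:R))^-1)); last first.
  apply/funext => r; rewrite invfM mulrA; congr (_ * (Gamma _)^-1).
  by rewrite -natr1; ring.
apply: (@tannery R (fun n r => x ^+ r / r`!%:R * inv_gamma_approx n (1 - a * r.+1%:R))
  _ (wright_bound a K) _ cB) => [n r|r].
  by apply: wright_term_bound => //; exact: ltW.
by apply: cvgMr; exact: inv_gamma_approx_cvg.
Qed.

Lemma wright_approx_bound {R : realType} (a c s K : R) n : 0 < a < 1 -> 0 < c -> 0 < K ->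
  `|s| <= K * c -> `|wright_approx a c n s| <= c^-1 * limn (series (wright_bound a K)).
Proof.
move=> a01 c0 K0 sK; have /andP[a0 a1] := a01.
have cB := cvg_series_wright_bound a01 K0.
have xK : `|- (s / c)| <= K.
  by rewrite normrN normrM normfV (gtr0_norm c0) ler_pdivrMr.
have tB r : `|(- (s / c)) ^+ r / r`!%:R * inv_gamma_approx n (1 - a * r.+1%:R)| <=
    wright_bound a K r by apply: wright_term_bound => //; exact: ltW.
rewrite wright_approxE//; last exact: series_le_cvg_norm cB.
rewrite normrM gtr0_norm ?invr_gt0// ler_wpM2l ?invr_ge0 ?(ltW c0)//.
exact: norm_lim_series_le.
Qed.

(** Termwise integration produces [Gamma(d + k + 1)], which is [Gamma(d + 1)] times the rising
    product of [d + 1]; the sum over [k] is then [sum_wright_coef] at [d + 1]. *)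
Lemma integral_wright_approx {R : realType} (a c d : R) n : 0 <= a <= 1 -> 0 < c ->
  0 <= d -> (0 < n)%N ->
  (\int[lebesgue_measure]_(s in `]0%R, +oo[) (s `^ d * wright_approx a c n s)%:E =
   (c `^ d * Gamma (d + 1) * inv_gamma_approx n (1 + a * d))%:E)%E.
Proof.
move=> a01 c0 d0 n0; set y := n%:R `^ a / c.
have n0' : 0 < n%:R :> R by rewrite ltr0n.
have y0 : 0 < y by rewrite divr_gt0// powR_gt0.
pose C (k : nat) := y / n`!%:R * wright_coef a n k * y ^+ k.
have C0 k : 0 <= C k.
  apply: mulr_ge0; last by rewrite exprn_ge0// ltW.
  apply: mulr_ge0; last exact: wright_coef_ge0.
  by rewrite divr_ge0 ?(ltW y0).
have meas k : measurable_fun (pos R)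
    (fun s : R => (s `^ (d + k.+1%:R - 1) * expR (- (y * s)))%:E).
  apply/measurable_EFinP; apply: measurable_gamma_integrand.
  by apply: measurableT_comp.
transitivity (\int[lebesgue_measure]_(s in `]0%R, +oo[)
   (\sum_(k < n.+1) (C k)%:E * (s `^ (d + k.+1%:R - 1) * expR (- (y * s)))%:E))%E.
  apply: eq_integral => s; rewrite inE/= in_itv/= andbT => s0.
  under eq_bigr do rewrite -EFinM; rewrite sumEFin; congr EFin.
  rewrite /wright_approx -/y !mulr_sumr; apply: eq_bigr => k _.
  have -> : s `^ (d + k.+1%:R - 1) = s `^ d * s ^+ k.
    rewrite -powR_mulrn ?(ltW s0)// -powRD ?(gt_eqF s0) ?implybT//.
    by congr powR; rewrite -natr1; ring.
  by rewrite /C exprMn; ring.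
rewrite ge0_integral_sum//; last 2 first.
- by move=> k; apply: measurable_funeM; exact: meas.
- by move=> k s _; rewrite mule_ge0 ?lee_fin// mulr_ge0 ?powR_ge0 ?expR_ge0.
transitivity (\sum_(k < n.+1) (C k * (y `^ (- (d + k.+1%:R)) * gamma_integral (d + k.+1%:R)))%:E)%E.
  apply: eq_bigr => k _; rewrite ge0_integralZl//.
  - by rewrite integral_gamma_scale// ltr_wpDl.
  - exact: meas.
  - by move=> s _; rewrite lee_fin mulr_ge0 ?powR_ge0 ?expR_ge0.
  - by rewrite lee_fin.
rewrite sumEFin; congr EFin.
have d1 : 0 < d + 1 by rewrite ltr_wpDl.
have Gk k : gamma_integral (d + k.+1%:R) = \prod_(i < k) (d + 1 + i%:R) * Gamma (d + 1).
  rewrite GammaE//; elim: k => [|k IH]; first by rewrite big_ord0 mul1r.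
  have -> : d + k.+2%:R = d + k.+1%:R + 1 by rewrite -[in LHS]natr1 addrA.
  rewrite gamma_integralS; last by rewrite ltr_wpDl.
  rewrite IH big_ord_recr/= [RHS]mulrC mulrCA mulrA [X in _ = X]mulrC.
  by have -> : d + k.+1%:R = d + 1 + k%:R by rewrite -natr1; ring.
move: (Gamma (d + 1)) Gk => G Gk.
transitivity (y `^ (- d) * G / n`!%:R * \sum_(k < n.+1) wright_coef a n k *
    \prod_(i < k) (d + 1 + i%:R)).
  rewrite mulr_sumr; apply: eq_bigr => k _; rewrite Gk /C.
  have -> : y `^ (- (d + k.+1%:R)) = y `^ (- d) * (y ^- k.+1).
    rewrite -powR_invn ?(ltW y0)// -powRD ?(gt_eqF y0) ?implybT//.
    by congr powR; ring.
  by rewrite exprS; field; rewrite !gt_eqF ?exprn_gt0// ltr0n fact_gt0.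
rewrite sum_wright_coef /inv_gamma_approx.
have -> : y `^ (- d) = c `^ d * n%:R `^ (1 - (1 + a * d)).
  rewrite /y powRM ?powR_ge0 ?invr_ge0 ?(ltW c0)// -powRrM mulrC; congr (_ * _).
    by rewrite -powR_inv1 ?(ltW c0)// -powRrM; congr powR; ring.
  by congr powR; ring.
have -> : \prod_(j < n) (1 + a * (d + 1 - 1) + j%:R) = \prod_(j < n) (1 + a * d + j%:R) :> R.
  by apply: eq_bigr => j _; ring.
ring.
Qed.

(* Uniform integrability at infinity comes from the next moment. *)
Lemma integral_cvg_of_moment {R : realType} (f_ : nat -> R -> R) (f : R -> R)
    (I J : nat -> R) (i j : R) :
  (forall n, measurable_fun (pos R) (f_ n)) ->
  (forall n s, 0 < s -> 0 <= f_ n s) ->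
  (forall s, 0 < s -> f_ n s @[n --> \oo] --> f s) ->
  (forall K, 0 < K -> exists M, forall n s, 0 < s <= K -> f_ n s <= M) ->
  (forall n, \int[lebesgue_measure]_(s in `]0%R, +oo[) (f_ n s)%:E = (I n)%:E)%E ->
  (forall n, \int[lebesgue_measure]_(s in `]0%R, +oo[) (s * f_ n s)%:E = (J n)%:E)%E ->
  I n @[n --> \oo] --> i -> J n @[n --> \oo] --> j ->
  (\int[lebesgue_measure]_(s in `]0%R, +oo[) (f s)%:E = i%:E)%E.
Proof.
move=> mf_ f0_ f_f fM intf intsf Ii Jj.
have mf : measurable_fun (pos R) f.
  by apply: measurable_fun_cvg mf_ _ => s /=; rewrite in_itv/= andbT; exact: f_f.
have mEf_ n : measurable_fun (pos R) (fun s => (f_ n s)%:E) by exact/measurable_EFinP.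
have mEf : measurable_fun (pos R) (fun s => (f s)%:E) by exact/measurable_EFinP.
have f0 s : 0 < s -> 0 <= f s.
  move=> s0; have := f_f s s0; rewrite -[f s]/(f s) => H.
  rewrite -(cvg_lim _ H)//; apply: limr_ge; first by apply/cvg_ex; eexists; exact: H.
  by apply: nearW => n; exact: f0_.
(* Fatou gives one inequality; the other says that no mass escapes to infinity. *)
apply/eqP; rewrite eq_le; apply/andP; split.
  have H : (EFin \o I) n @[n --> \oo] --> i%:E by exact: cvg_EFin (nearW _ _) Ii.
  have -> : i%:E = limn_einf (EFin \o I) by rewrite (cvg_limn_einf_sup H).1.
  have -> : EFin \o I = (fun n => \int[lebesgue_measure]_(s in `]0%R, +oo[) (f_ n s)%:E)%E.
    by apply/funext => n; rewrite intf.
  have mpos : measurable (pos R) by exact: measurable_itv.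
  apply: (le_trans _ (@fatou _ _ R lebesgue_measure (pos R) mpos (fun n s => (f_ n s)%:E) mEf_ _)).
    rewrite le_eqVlt; apply/orP; left; apply/eqP.
    apply: eq_integral => s; rewrite inE/= in_itv/= andbT => s0.
    have fs : (f_ n s)%:E @[n --> \oo] --> (f s)%:E.
      exact: cvg_EFin (nearW _ _) (f_f _ s0).
    by rewrite (cvg_limn_einf_sup fs).1.
  by move=> n s /=; rewrite in_itv/= andbT lee_fin; exact: f0_.
(* On []0, K]] the uniform bound [M] allows dominated convergence. Beyond [K] one has [1 <= s / K],
   so the tail costs at most [J n / K]. *)
have main K : 0 < K -> (i%:E <= \int[lebesgue_measure]_(s in `]0%R, +oo[) (f s)%:E + (j / K)%:E)%E.
  move=> K0; have [M HM] := fM K K0.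
  have sub : `]0, K]%classic `<=` `]0, +oo[%classic.
    by move=> s /=; rewrite !in_itv/= andbT => /andP[].
  have mD : measurable (`]0, K]%classic : set R) by exact: measurable_itv.
  have cA : (\int[lebesgue_measure]_(s in `]0%R, K]) (f_ n s)%:E)%E @[n --> \oo] -->
     (\int[lebesgue_measure]_(s in `]0%R, K]) (f s)%:E)%E.
    apply: (@dominated_cvg _ _ R lebesgue_measure _ mD (fun n s => (f_ n s)%:E)
      (fun s => (f s)%:E) (cst M%:E)).
    - by move=> n; exact: measurable_funS (mEf_ n).
    - move=> s /=; rewrite in_itv/= => /andP[s0 _].
      exact: cvg_EFin (nearW _ _) (f_f _ s0).
    - by [].
    - apply/integrableP; split; first exact: measurable_cst.
      rewrite integral_cst//= lebesgue_measure_itv/= lte_fin K0.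
      by rewrite -EFinB -EFinM ltry.
    - move=> n s /=; rewrite in_itv/= => sK; have /andP[s0 _] := sK.
      by rewrite lee_fin ger0_norm ?f0_// HM.
  have leA n : ((I n)%:E <= \int[lebesgue_measure]_(s in `]0%R, K]) (f_ n s)%:E + (J n / K)%:E)%E.
    have E : (pos R) = `]0, K]%classic `|` `]K, +oo[%classic.
      by apply: itv_bndbnd_setU; rewrite bnd_simp// ltW.
    rewrite -intf {1}E ge0_integral_setU//=; last 3 first.
    - by rewrite -E; exact: mEf_.
    - move=> s; case; rewrite in_itv/= ?andbT.
        by move=> /andP[s0 _]; rewrite lee_fin f0_.
      by move=> Ks; rewrite lee_fin f0_// (lt_trans K0 Ks).
    - rewrite disj_set2E; apply/eqP/seteqP; split=> [s []|s []]//=.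
      by rewrite !in_itv/= andbT => /andP[_ sK]; rewrite ltNge sK.
    apply: leeD => //.
    have -> : (J n / K)%:E =
       (\int[lebesgue_measure]_(s in `]0%R, +oo[) (K^-1%:E * (s * f_ n s)%:E))%E.
      rewrite ge0_integralZl//=.
      - by rewrite intsf -EFinM mulrC.
      - apply/measurable_EFinP; apply: measurable_funM => //; exact: mf_.
      - by move=> s; rewrite in_itv/= andbT => s0; rewrite lee_fin mulr_ge0 ?f0_ ?(ltW s0).
      - by rewrite lee_fin invr_ge0 ltW.
    have mK : measurable_fun (pos R) (fun s => (K^-1%:E * (s * f_ n s)%:E)%E).
      apply: measurable_funeM; apply/measurable_EFinP; apply: measurable_funM => //.
    apply: (@le_trans _ _ (\int[lebesgue_measure]_(s in `]K, +oo[) (K^-1%:E * (s * f_ n s)%:E))%E).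
      apply: ge0_le_integral => //=.
      - move=> s; rewrite in_itv/= andbT => Ks; rewrite lee_fin f0_//; exact: lt_trans Ks.
      - by apply: measurable_funS (mEf_ n) => //; rewrite E; exact: subsetUr.
      - by apply: measurable_funS mK => //; rewrite E; exact: subsetUr.
      - move=> s; rewrite in_itv/= andbT => Ks; rewrite -EFinM lee_fin mulrA.
        rewrite ler_peMl ?f0_ ?(lt_trans K0 Ks)//.
        by rewrite mulrC ler_pdivlMr// mul1r ltW.
    apply: ge0_subset_integral => //=.
    - move=> s; rewrite in_itv/= andbT => s0.
      by rewrite -EFinM lee_fin !mulr_ge0 ?f0_ ?invr_ge0 ?(ltW s0) ?(ltW K0).
    - by rewrite [X in _ `<=` X]E; exact: subsetUr.
  have fin : (\int[lebesgue_measure]_(s in `]0%R, K]) (f s)%:E)%E \is a fin_num \/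
     (\int[lebesgue_measure]_(s in `]0%R, K]) (f s)%:E = +oo)%E.
    have : (0 <= \int[lebesgue_measure]_(s in `]0%R, K]) (f s)%:E)%E.
      by apply: integral_ge0 => s /=; rewrite in_itv/= lee_fin => /andP[s0 _]; exact: f0.
    by case: (\int[_]_(_ in _) _)%E => // [r|] _; [left|right].
  have cJ : (J n / K)%:E @[n --> \oo] --> (j / K)%:E.
    apply: cvg_EFin; first exact: nearW.
    by apply: cvgMl.
  have cI : (I n)%:E @[n --> \oo] --> i%:E by exact: cvg_EFin (nearW _ _) Ii.
  have cAJ : (\int[lebesgue_measure]_(s in `]0%R, K]) (f_ n s)%:E + (J n / K)%:E)%E @[n --> \oo] -->
     (\int[lebesgue_measure]_(s in `]0%R, K]) (f s)%:E + (j / K)%:E)%E.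
    apply: cvgeD => //.
    by rewrite fin_num_adde_defl.
  have : (i%:E <= \int[lebesgue_measure]_(s in `]0%R, K]) (f s)%:E + (j / K)%:E)%E.
    rewrite -(cvg_lim _ cI)// -(cvg_lim _ cAJ)//; apply: lee_lim.
    - by apply/cvg_ex; eexists; exact: cI.
    - by apply/cvg_ex; eexists; exact: cAJ.
    - exact: nearW.
  move/le_trans; apply; apply: leeD => //.
  apply: ge0_subset_integral => //=.
  by move=> s; rewrite in_itv/= andbT lee_fin; exact: f0.
apply/lee_addgt0Pr => e e0.
(* With [K = (|j| + 1) / e] the tail term [j / K] is at most [e]; adding 1 keeps [K] positive when
   [j = 0]. *)
have j1 : 0 < `|j| + 1 by rewrite ltr_wpDl.
apply: le_trans (main ((`|j| + 1) / e) (divr_gt0 j1 e0)) _.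
apply: leeD => //; rewrite lee_fin invf_div mulrA ler_pdivrMr// mulrC ler_pM2l//.
by rewrite (le_trans (ler_norm j))// lerDl.
Qed.

Lemma random_time_densityE {R : realType} (b t s : R) :
  random_time_density b t s = (t `^ b)^-1 * wright (- b) (1 - b) (- (s / t `^ b)).
Proof. by rewrite /random_time_density powRN. Qed.

Lemma cvg_random_time_density {R : realType} (b t s : R) : 0 < b < 1 -> 0 < t ->
  wright_approx b (t `^ b) n s @[n --> \oo] --> random_time_density b t s.
Proof.
by move=> b01 t0; rewrite random_time_densityE; apply: cvg_wright_approx => //; exact: powR_gt0.
Qed.

Lemma random_time_density_ge0 {R : realType} (b t s : R) : 0 < b < 1 -> 0 < t ->
  0 <= s -> 0 <= random_time_density b t s.
Proof.
move=> b01 t0 s0; have H := @cvg_random_time_density R b t s b01 t0.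
rewrite -(cvg_lim _ H)//; apply: limr_ge; first by apply/cvg_ex; eexists; exact: H.
apply: nearW => n; apply: wright_approx_ge0 => //; last exact: powR_gt0.
by move: b01 => /andP[/ltW-> /ltW->].
Qed.

Lemma measurable_random_time_density {R : realType} (b t : R) (D : set R) :
  0 < b < 1 -> 0 < t -> measurable_fun D (random_time_density b t).
Proof.
move=> b01 t0; apply: measurable_fun_cvg => [n|s _]; last exact: cvg_random_time_density.
exact: measurable_wright_approx.
Qed.

Lemma integral_random_time_density {R : realType} (b t d : R) : 0 < b < 1 -> 0 < t ->
  0 <= d ->
  (\int[lebesgue_measure]_(s in `]0%R, +oo[) (s `^ d * random_time_density b t s)%:E =
   (t `^ (b * d) * Gamma (d + 1) / Gamma (1 + b * d))%:E)%E.
Proof.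
move=> b01 t0 d0; have /andP[b0 b1] := b01.
have b01' : 0 <= b <= 1 by rewrite (ltW b0) (ltW b1).
have c0 : 0 < t `^ b by exact: powR_gt0.
pose M (d : R) := t `^ b `^ d * Gamma (d + 1).
have cM (e : R) : M e * inv_gamma_approx n.+1 (1 + b * e) @[n --> \oo] -->
    M e / Gamma (1 + b * e).
  apply: cvgMr; have := @inv_gamma_approx_cvg R (1 + b * e).
  by rewrite -cvg_shiftS.
(* The index is shifted to [n.+1] because the moment formula requires a positive one. Multiplying by
   [s] turns the moment of order [d] into that of order [d + 1]. *)
rewrite powRrM; apply: (@integral_cvg_of_moment R
  (fun n s => s `^ d * wright_approx b (t `^ b) n.+1 s) _ _ _ _ _ _ _ _ _ _ _
  (cM d) (cM (d + 1))).
- move=> n; apply: measurable_funM; first by apply: measurable_funTS; exact: measurable_powR.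
  exact: measurable_wright_approx.
- by move=> n s s0; rewrite mulr_ge0 ?powR_ge0// wright_approx_ge0// ltW.
- move=> s s0; apply: cvgMr; have := @cvg_random_time_density R b t s b01 t0.
  by rewrite -cvg_shiftS.
- move=> K K0; exists (K `^ d * ((t `^ b)^-1 * limn (series (wright_bound b (K / t `^ b))))).
  move=> n s /andP[s0 sK]; apply: ler_pM; rewrite ?powR_ge0 ?wright_approx_ge0 ?(ltW s0)//.
    by rewrite ge0_ler_powR// nnegrE ltW.
  apply: le_trans (ler_norm _) _; apply: wright_approx_bound => //.
    by rewrite divr_gt0.
  by rewrite divfK ?gt_eqF// gtr0_norm.
- by move=> n; rewrite integral_wright_approx.
- move=> n; rewrite -integral_wright_approx//; last by rewrite addr_ge0.
  apply: eq_integral => s; rewrite inE/= in_itv/= andbT => s0; congr EFin.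
  rewrite mulrA; congr (_ * _).
  by rewrite -[X in X * _]powRr1 ?(ltW s0)// -powRD ?(gt_eqF s0) ?implybT// addrC.
Qed.

Section density.
Import HBNNSimple.

(** [random_time] prescribes the law set by set. The change of density for functions follows from
    simple functions by monotone convergence. *)
Lemma ge0_integral_density {d} {T : measurableType d} {R : realType}
    (mu m : {measure set T -> \bar R}) (D : set T) (h : T -> R) :
  measurable D -> measurable_fun D h -> (forall x, D x -> 0 <= h x) ->
  (forall A, measurable A -> m A = \int[mu]_(x in A `&` D) (h x)%:E)%E ->
  forall f : T -> \bar R, measurable_fun setT f -> (forall x, (0 <= f x)%E) ->
  (\int[m]_x f x = \int[mu]_(x in D) (f x * (h x)%:E))%E.
Proof.
move=> mD mh h0 mE f mf f0.
pose f_ := nnsfun_approx measurableT mf.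
have cf x : (f_ n x)%:E @[n --> \oo] --> f x by apply: cvg_nnsfun_approx.
have mfh n : measurable_fun D (fun x => ((f_ n x)%:E * (h x)%:E)%E).
  by apply/measurable_EFinP; apply: measurable_funM => //; apply: measurable_funTS.
transitivity (limn (fun n => \int[m]_x (f_ n x)%:E)%E).
  rewrite -monotone_convergence//.
  - by apply: eq_integral => y _; apply/esym/cvg_lim => //; exact: cf.
  - by move=> n; apply/measurable_EFinP.
  - by move=> n y _; rewrite lee_fin.
  - by move=> y _ k n kn; rewrite lee_fin; exact/lefP/nd_nnsfun_approx.
transitivity (limn (fun n => \int[mu]_(x in D) ((f_ n x)%:E * (h x)%:E))%E); last first.
  rewrite -monotone_convergence//.
  - apply: eq_integral => y; rewrite inE => Dy; apply/cvg_lim => //.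
    exact: cvgeZr (cf y).
  - by move=> n y Dy; rewrite mule_ge0 ?lee_fin// h0.
  - move=> y Dy k n kn; apply: lee_wpmul2r; rewrite lee_fin ?h0//.
    exact/lefP/nd_nnsfun_approx.
congr (limn _); apply/funext => n.
rewrite integralT_nnsfun sintegralE.
rewrite [RHS](_ : _ = \int[mu]_(x in D)
    (\sum_(k \in range (f_ n)) (k * \1_(f_ n @^-1` [set k]) x)%:E * (h x)%:E))%E; last first.
  apply: eq_integral => x _; rewrite fimfunE -fsumEFin//.
  rewrite ge0_mule_fsuml// => k; exact: nnfun_muleindic_ge0.
rewrite ge0_integral_fsum//; last 2 first.
- move=> k; apply/measurable_EFinP; apply: measurable_funM => //.
  by apply: measurable_funTS; apply: measurable_funM.
- by move=> k x Dx; rewrite mule_ge0 ?lee_fin ?h0// -lee_fin EFinM nnfun_muleindic_ge0.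
apply: eq_fsbigr => k; rewrite inE => -[x _ <-].
have mA : measurable (f_ n @^-1` [set f_ n x]) by exact: measurable_sfunP.
rewrite mE// setIC integral_mkcondr -ge0_integralZl//; last 3 first.
- apply/measurable_restrict => //; apply/measurable_EFinP.
  by apply: measurable_funS mh => //; exact: subIsetl.
- by move=> y Dy; rewrite patchE; case: ifP => // _; rewrite lee_fin h0.
- by rewrite lee_fin fun_ge0.
apply: eq_integral => y _; rewrite patchE indicE.
by case: ifP => _; rewrite ?mulr1 ?mulr0 ?mul0e ?mule0.
Qed.

End density.

(** * Moments of the random time and Mittag-Leffler functions *)

Lemma random_time_moment {R : realType} {d} {T : measurableType d}
    {P : probability T R} (b : R) (tau : R -> {RV P >-> R}) (t e : R) :
  random_time b tau -> 0 < b <= 1 -> 0 < t -> 0 <= e ->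
  (\int[P]_w (tau t w `^ e)%:E =
   (t `^ (b * e) * Gamma (e + 1) / Gamma (1 + b * e))%:E)%E.
Proof.
move=> [tau0 taud tau1] /andP[b0]; rewrite le_eqVlt => /predU1P[b1|b1] t0 e0.
  have G0 : 0 < Gamma (1 + 1 * e) by rewrite Gamma_gt0// mul1r ltr_pwDl.
  under eq_integral do rewrite tau1 ?(ltW t0)//.
  transitivity ((t `^ e)%:E * P setT)%E; first exact: integral_cst.
  rewrite probability_setT mule1 b1.
  have -> : Gamma (e + 1) = Gamma (1 + 1 * e) by rewrite mul1r addrC.
  by rewrite mulfK ?gt_eqF// mul1r.
have b01 : 0 < b < 1 by rewrite b0.
have mpow : measurable_fun setT (fun s : R => (s `^ e)%:E).
  by apply/measurable_EFinP; exact: measurable_powR.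
have mtau : measurable_fun setT (tau t : T -> measurableTypeR R).
  exact: (measurable_funPT (tau t)).
pose phi : {mfun T >-> measurableTypeR R} :=
  HB.pack (tau t : T -> measurableTypeR R) (isMeasurableFun.Build _ _ _ _ _ mtau).
have mpos : measurable (pos R) by exact: measurable_itv.
have dens0 s : pos R s -> 0 <= random_time_density b t s.
  by rewrite /= in_itv/= andbT => s0; rewrite random_time_density_ge0// ltW.
have pow0 (s : measurableTypeR R) : (0 <= (s `^ e)%:E)%E by rewrite lee_fin powR_ge0.
have mdens : measurable_fun (pos R) (random_time_density b t).
  exact: measurable_random_time_density.
have := @ge0_integral_density _ _ R lebesgue_measure (pushforward P phi)
  (pos R) (random_time_density b t) mpos
  mdens dens0 _ _ mpow pow0.
rewrite -integral_random_time_density// => /(_ mtau) H.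
transitivity (\int[lebesgue_measure]_(s in `]0%R, +oo[)
  ((s `^ e)%:E * (random_time_density b t s)%:E))%E; last first.
  by apply: eq_integral => s _; rewrite EFinM.
rewrite -H; last by move=> A mA; exact: (taud b1 _ t0 _ mA).
by rewrite (@ge0_integral_pushforward _ _ _ _ R _ mtau P setT _ measurableT mpow)// => s _.
Qed.

(** For [b < 1] the law is carried by []0, +oo[], and for [b = 1] the time is [t]. Formulas
    available at positive times only can thus be inserted under an outer random time. *)
Lemma random_time_gt0 {R : realType} {d} {T : measurableType d}
    {P : probability T R} (b : R) (tau : R -> {RV P >-> R}) (t : R) :
  random_time b tau -> 0 < b <= 1 -> 0 < t -> {ae P, forall w, 0 < tau t w}.
Proof.
move=> [tau0 taud tau1] /andP[b0]; rewrite le_eqVlt => /predU1P[b1|b1] t0.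
  by apply: aeW => w; rewrite tau1 ?ltW.
exists (tau t @^-1` [set 0]); split.
- by rewrite -[X in measurable X]setTI; exact: measurable_funP.
- by rewrite taud// (_ : _ `&` _ = set0) ?integral_set0// -subset0 => s [/= ->];
    rewrite in_itv/= ltxx.
- move=> w /= /negP; rewrite -leNgt => tw0; apply/eqP.
  by rewrite eq_le tw0 tau0// ltW.
Qed.

Lemma cvg_mittag_leffler {R : realType} (b x : R) : 0 < b ->
  cvgn (series (fun h : nat => x ^+ h / Gamma (b * h%:R + 1))).
Proof.
(* [A] solves [A^b = 2 (|x| + 1)], so that [gamma_integral_ge] bounds the [h]-th term by
   [e^(A + 1) 2^(-h)]. *)
move=> b0; pose A := (2 * (`|x| + 1)) `^ b^-1.
have x1 : 0 < 2 * (`|x| + 1) by rewrite mulr_gt0// ltr_wpDl.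
have A0 : 0 < A by exact: powR_gt0.
have Ab : A `^ b = 2 * (`|x| + 1).
  by rewrite -powRrM mulVf ?gt_eqF// powRr1// ltW.
apply: (@series_le_cvg_norm _ _ (geometric (expR (A + 1)) 2^-1)); last first.
  by apply: is_cvg_geometric_series; rewrite ger0_norm// invf_lt1// ltr1n.
move=> h /=.
have bh : 1 <= b * h%:R + 1 by rewrite lerDr mulr_ge0// ltW.
have bh0 : 0 < b * h%:R + 1 by exact: lt_le_trans bh.
have G0 := Gamma_gt0 bh0.
have := gamma_integral_ge bh A0; rewrite -GammaE// addrK.
rewrite powRrM Ab powR_mulrn ?(ltW x1)// => H.
rewrite normrM normrX (gtr0_norm (x := _^-1)) ?invr_gt0// ler_pdivrMr//.
rewrite (@le_trans _ _ (expR (A + 1) * 2^-1 ^+ h * ((2 * (`|x| + 1)) ^+ h * expR (- (A + 1)))))//.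
  rewrite exprMn !mulrA -[_ * 2^-1 ^+ h * 2 ^+ h]mulrA -exprMn mulVf// expr1n mulr1.
  rewrite mulrAC -expRD subrr expR0 mul1r lerXn2r ?nnegrE ?addr_ge0//.
  by rewrite lerDl.
by rewrite ler_wpM2l// mulr_ge0 ?expR_ge0// exprn_ge0.
Qed.

Lemma mittag_leffler1 {R : realType} (x : R) : mittag_leffler 1 x = expR x.
Proof.
rewrite /mittag_leffler (_ : (fun h : nat => _) = exp_coeff x)//.
apply/funext => h; rewrite mul1r natr1 GammaE ?ltr0n// gamma_integral_nat.
by [].
Qed.

(** The factor [Gamma(nu h + 1)] in the moment of order [nu h] cancels the denominator of the
    series, leaving the series of order [nu b]. The exchange is dominated by the same series at
    [+ l], whose terms are nonnegative and whose integral is the finite value of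
    [mittag_leffler (nu * b)] at [l t^(nu b)]. *)
Lemma integral_mittag_leffler {R : realType} {d} {T : measurableType d}
    {P : probability T R} (nu b l t : R) (Y : T -> R) :
  0 < nu -> 0 < b -> 0 <= l -> measurable_fun setT Y -> (forall w, 0 <= Y w) ->
  (forall e : R, 0 <= e -> (\int[P]_w (Y w `^ e)%:E =
     (t `^ (b * e) * Gamma (e + 1) / Gamma (1 + b * e))%:E)%E) ->
  P.-integrable setT (fun w => (mittag_leffler nu (- l * Y w `^ nu))%:E) /\
  (\int[P]_w (mittag_leffler nu (- l * Y w `^ nu))%:E =
   (mittag_leffler (nu * b) (- l * t `^ (nu * b)))%:E)%E.
Proof.
move=> nu0 b0 l0 mY Y0 mom.
have h0 (h : nat) : 0 <= nu * h%:R by rewrite mulr_ge0// ltW.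
have Gp (h : nat) : 0 < Gamma (nu * h%:R + 1) by rewrite Gamma_gt0// ltr_wpDl.
pose c (h : nat) : R := l ^+ h / Gamma (nu * h%:R + 1).
have c0 h : 0 <= c h by rewrite divr_ge0 ?exprn_ge0// ltW.
have termE (x : R) w h : (x * Y w `^ nu) ^+ h = x ^+ h * Y w `^ (nu * h%:R).
  by rewrite exprMn powRrM powR_mulrn// powR_ge0.
have mpow h : measurable_fun setT (fun w => (Y w `^ (nu * h%:R))%:E).
  by apply/measurable_EFinP; apply: (measurableT_comp (measurable_powR _)).
have intpow h : P.-integrable setT (fun w => (Y w `^ (nu * h%:R))%:E).
  apply/integrableP; split => //.
  under eq_integral do rewrite gee0_abs ?lee_fin ?powR_ge0//.
  by rewrite mom// ltry.
have momc (x : R) h : (x ^+ h / Gamma (nu * h%:R + 1)) *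
    (t `^ (b * (nu * h%:R)) * Gamma (nu * h%:R + 1) / Gamma (1 + b * (nu * h%:R))) =
    (x * t `^ (nu * b)) ^+ h / Gamma (nu * b * h%:R + 1).
  have -> : Gamma (1 + b * (nu * h%:R)) = Gamma (nu * b * h%:R + 1).
    by congr Gamma; ring.
  have -> : t `^ (b * (nu * h%:R)) = (t `^ (nu * b)) ^+ h.
    by rewrite -powR_mulrn ?powR_ge0// -powRrM; congr powR; ring.
  rewrite exprMn; have := negbT (gt_eqF (Gp h)).
  move: (Gamma (nu * h%:R + 1)) (Gamma (nu * b * h%:R + 1))^-1 => g g' g0.
  by field.
pose f_ (n : nat) w : \bar R :=
  (series (fun h => (- l * Y w `^ nu) ^+ h / Gamma (nu * h%:R + 1)) n)%:E.
pose g w : \bar R := (\sum_(0 <= h <oo) (c h * Y w `^ (nu * h%:R))%:E)%E.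
have fE n w : f_ n w =
    (\sum_(0 <= h < n) (((- l) ^+ h / Gamma (nu * h%:R + 1))%:E * (Y w `^ (nu * h%:R))%:E))%E.
  rewrite /f_ /series/= -sumEFin; apply: eq_bigr => h _.
  by rewrite termE -EFinM mulrAC.
have mf_ n : measurable_fun setT (f_ n).
  rewrite (_ : f_ n = (fun w => \sum_(0 <= h < n)
    (((- l) ^+ h / Gamma (nu * h%:R + 1))%:E * (Y w `^ (nu * h%:R))%:E))%E); last first.
    by apply/funext => w; exact: fE.
  by apply: emeasurable_sum => h; exact: measurable_funeM.
have nub0 : 0 < nu * b by rewrite mulr_gt0.
have f_f w : f_ n w @[n --> \oo] --> (mittag_leffler nu (- l * Y w `^ nu))%:E.
  apply: cvg_EFin; first exact: nearW.
  exact: cvg_mittag_leffler.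
have mf : measurable_fun setT (fun w => (mittag_leffler nu (- l * Y w `^ nu))%:E).
  by apply: emeasurable_fun_cvg mf_ _ => w _; exact: f_f.
have mg : measurable_fun setT g.
  apply: ge0_emeasurable_sum => [h w _ _|h _].
    by rewrite lee_fin mulr_ge0 ?powR_ge0.
  by under eq_fun do rewrite EFinM; exact: measurable_funeM.
have g0 w : (0 <= g w)%E by apply: nneseries_ge0 => h _ _; rewrite lee_fin mulr_ge0 ?powR_ge0.
have ig : P.-integrable setT g.
  apply/integrableP; split => //.
  under eq_integral do rewrite gee0_abs//.
  rewrite integral_nneseries//; last 2 first.
  - by move=> h; under eq_fun do rewrite EFinM; exact: measurable_funeM.
  - by move=> h w _; rewrite lee_fin mulr_ge0 ?powR_ge0.
  rewrite (_ : (\sum_(0 <= h <oo) _)%E =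
     (mittag_leffler (nu * b) (l * t `^ (nu * b)))%:E) ?ltry//.
  rewrite /mittag_leffler -EFin_lim; last exact: cvg_mittag_leffler.
  congr (limn _); apply/funext => n.
  rewrite /= /series/= -sumEFin; apply: eq_bigr => h _.
  under eq_integral do rewrite EFinM.
  rewrite ge0_integralZl//; first by rewrite mom// -EFinM momc.
    by move=> w _; rewrite lee_fin powR_ge0.
  by rewrite lee_fin.
have fg n w : (`|f_ n w| <= g w)%E.
  apply: (@le_trans _ _ (\sum_(0 <= h < n) (c h * Y w `^ (nu * h%:R))%:E)%E).
    rewrite /f_ /series/= sumEFin lee_fin; apply: le_trans (ler_norm_sum _ _ _) _.
    apply: ler_sum => h _; rewrite termE normrM [`|_^-1|]gtr0_norm ?invr_gt0//.
    rewrite normrM normrX normrN (ger0_norm l0) (ger0_norm (powR_ge0 _ _)).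
    by rewrite mulrAC.
  by apply: nneseries_lim_ge => h _ _; rewrite lee_fin mulr_ge0 ?powR_ge0.
have ae_f : {ae P, forall w, setT w ->
    f_ ^~ w @ \oo --> (mittag_leffler nu (- l * Y w `^ nu))%:E}.
  by apply: aeW => w _; exact: f_f.
have ae_fg : {ae P, forall w n, setT w -> (`|f_ n w| <= g w)%E}.
  by apply: aeW => w n _; exact: fg.
have [if_ _ cint] := dominated_convergence measurableT mf_ mf ae_f ig ae_fg.
split => //.
have cint' : (\int[P]_w f_ n w)%E @[n --> \oo] -->
    (mittag_leffler (nu * b) (- l * t `^ (nu * b)))%:E.
  rewrite (_ : (fun n => (\int[P]_w f_ n w)%E) = (fun n =>
     (series (fun h => (- l * t `^ (nu * b)) ^+ h / Gamma (nu * b * h%:R + 1)) n)%:E)).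
    by apply: cvg_EFin; [exact: nearW|exact: cvg_mittag_leffler].
  apply/funext => n; under eq_integral do rewrite fE.
  rewrite integral_sum//; last by move=> h; exact: integrableZl.
  rewrite /series/= -sumEFin; apply: eq_bigr => h _.
  by rewrite integralZl// mom// -EFinM momc.
by rewrite -(cvg_lim _ cint)// -(cvg_lim _ cint').
Qed.

(** * Pure birth processes *)

(* For distinct nodes this is, up to the sign [(-1)^(k-i)], the divided
   difference of [f] at [x i, ..., x k]. *)
Definition divdiff_sum {R : fieldType} (x f : nat -> R) (i k : nat) : R :=
  \sum_(i <= m < k.+1) f m / \prod_(i <= l < k.+1 | l != m) (x l - x m).

Lemma divdiff_sumD {R : fieldType} (x f g : nat -> R) i k :
  divdiff_sum x (fun m => f m + g m) i k = divdiff_sum x f i k + divdiff_sum x g i k.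
Proof. by rewrite /divdiff_sum -big_split/=; apply: eq_bigr => m _; rewrite mulrDl. Qed.

Lemma divdiff_sumZ {R : fieldType} (x f : nat -> R) c i k :
  divdiff_sum x (fun m => c * f m) i k = c * divdiff_sum x f i k.
Proof. by rewrite /divdiff_sum mulr_sumr; apply: eq_bigr => m _; rewrite mulrA. Qed.

(** The weight [x i - x m] kills the term [m = i] and cancels the factor [l = i] in the others,
    which removes the node [x i]. *)
Lemma divdiff_sum_first {R : fieldType} (x f : nat -> R) i k :
  (forall a b, (i <= a)%N -> (i <= b)%N -> x a = x b -> a = b) -> (i <= k)%N ->
  divdiff_sum x (fun m => (x i - x m) * f m) i k = divdiff_sum x f i.+1 k.
Proof.
move=> inj ik; rewrite /divdiff_sum big_ltn ?ltnS// subrr mul0r mul0r add0r.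
apply: eq_big_nat => m /andP[im _].
rewrite [in LHS]big_ltn_cond ?ltnS// (ltn_eqF im).
have xm : x i - x m != 0.
  rewrite subr_eq0; apply/eqP => /inj; rewrite leqnn (ltnW im) => /(_ isT isT) E.
  by rewrite E ltnn in im.
by rewrite invfM mulrACA divff// mul1r.
Qed.

Lemma divdiff_sum_last {R : fieldType} (x f : nat -> R) i k :
  (forall a b, (i <= a)%N -> (i <= b)%N -> x a = x b -> a = b) -> (i <= k)%N ->
  divdiff_sum x (fun m => (x k.+1 - x m) * f m) i k.+1 = divdiff_sum x f i k.
Proof.
move=> inj ik; rewrite /divdiff_sum big_nat_recr/=; last exact: leqW.
rewrite subrr mul0r mul0r addr0.
apply: eq_big_nat => m /andP[im mk].
rewrite [in LHS]big_mkcond big_nat_recr/=; last exact: leqW.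
rewrite -big_mkcond/= (gtn_eqF mk)/=.
have xm : x k.+1 - x m != 0.
  rewrite subr_eq0; apply/eqP => /inj; rewrite im leqW// => /(_ isT isT) E.
  by rewrite -E ltnn in mk.
by rewrite [X in _ / X]mulrC invfM mulrACA divff// mul1r.
Qed.

(** For [i < k], [x i - x k] times the sum is the difference of the sums without the first and
    without the last node. These are both 1 when two nodes are present, and both 0 by induction when
    there are more. *)
Lemma divdiff_sum1 {R : fieldType} (x : nat -> R) i k :
  (forall a b, (i <= a)%N -> (i <= b)%N -> x a = x b -> a = b) -> (i <= k)%N ->
  divdiff_sum x (fun=> 1) i k = (i == k)%:R.
Proof.
move=> inj ik.
have diag j : divdiff_sum x (fun=> 1) j j = 1.
  by rewrite /divdiff_sum big_nat1 big_mkcond/= big_nat1 eqxx/= divr1.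
move: ik; rewrite leq_eqVlt => /predU1P[->|ik]; first by rewrite eqxx diag.
rewrite (ltn_eqF ik).
have step j k' : (forall a b, (j <= a)%N -> (j <= b)%N -> x a = x b -> a = b) ->
    (j <= k')%N -> divdiff_sum x (fun=> 1) j.+1 k'.+1 = divdiff_sum x (fun=> 1) j k' ->
    divdiff_sum x (fun=> 1) j k'.+1 = 0.
  move=> injj jk E.
  have xx : x j - x k'.+1 != 0.
    rewrite subr_eq0; apply/eqP => /injj; rewrite leqnn leqW// => /(_ isT isT) jE.
    by rewrite jE ltnn in jk.
  apply: (mulfI xx); rewrite mulr0 -divdiff_sumZ.
  transitivity (divdiff_sum x (fun m => (x j - x m) * 1) j k'.+1 +
     -1 * divdiff_sum x (fun m => (x k'.+1 - x m) * 1) j k'.+1).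
    rewrite -divdiff_sumZ -divdiff_sumD; congr (divdiff_sum _ _ _ _).
    by apply/funext => m; ring.
  by rewrite divdiff_sum_first ?leqW// divdiff_sum_last// E mulN1r subrr.
have [n kE] : exists n, k = (i + n.+1)%N.
  by exists (k - i).-1; rewrite prednK ?subn_gt0// subnKC// ltnW.
move: inj; rewrite {k ik}kE; elim: n i => [|n IH] i inj.
  by rewrite addn1 step// !diag.
rewrite addnS step ?leq_addr//.
rewrite -addSn IH ?IH// => a b ia ib.
by apply: inj; exact: ltnW.
Qed.

(** The classical formula for the transition from [i] to [k]. The initial state stays free because
    the backward equations couple [i] to [i.+1]. *)
Definition birth_prob {R : realType} (lam : nat -> R) (i k : nat) (t : R) : R :=
  \prod_(i <= j < k) lam j * divdiff_sum lam (fun m => expR (- lam m * t)) i k.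

Lemma birth_prob0 {R : realType} (lam : nat -> R) i k :
  (forall a b, (i <= a)%N -> (i <= b)%N -> lam a = lam b -> a = b) -> (i <= k)%N ->
  birth_prob lam i k 0 = (i == k)%:R.
Proof.
move=> inj ik; rewrite /birth_prob.
rewrite (_ : (fun m => expR (- lam m * 0)) = (fun=> 1)); last first.
  by apply/funext => m; rewrite mulr0 expR0.
rewrite divdiff_sum1//; case: eqVneq => [->|_]; last by rewrite mulr0.
by rewrite big_geq// mulr1.
Qed.

(** Writing [- lam m = - lam i + (lam i - lam m)], the second part loses the node [i] by
    [divdiff_sum_first], and the factor [lam i] of the product completes row [i.+1]. For [k = i] no
    node remains. *)
Lemma is_derive_birth_prob {R : realType} (lam : nat -> R) i k (t : R) :
  (forall a b, (i <= a)%N -> (i <= b)%N -> lam a = lam b -> a = b) -> (i <= k)%N ->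
  is_derive t 1 (birth_prob lam i k)
    (- lam i * birth_prob lam i k t +
     (if (i < k)%N then lam i * birth_prob lam i.+1 k t else 0)).
Proof.
move=> inj ik.
have D (s : seq nat) (c : nat -> R) : is_derive t 1
    (fun t => \sum_(m <- s) expR (- lam m * t) / c m)
    (\sum_(m <- s) (- lam m * expR (- lam m * t)) / c m).
  elim: s => [|m s IH].
    rewrite big_nil; under eq_fun do rewrite big_nil; exact: is_derive_cst.
  rewrite big_cons; under eq_fun do rewrite big_cons.
  apply: is_deriveD; apply: is_derive_eq.
  by rewrite /GRing.scale/=; ring.
have H := D (index_iota i k.+1) (fun m => \prod_(i <= l < k.+1 | l != m) (lam l - lam m)).
set F := (F in is_derive t 1 F _) in H.
set C : R := \prod_(i <= j < k) lam j.
have CF : is_derive t 1 (fun t => C * F t)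
    (C * divdiff_sum lam (fun m => - lam m * expR (- lam m * t)) i k).
  exact: is_derive_eq.
rewrite -[X in is_derive _ _ X]/(fun t => C * F t); apply: is_derive_eq.
rewrite /birth_prob.
set e := fun m => expR (- lam m * t).
have -> : divdiff_sum lam (fun m => - lam m * e m) i k =
    - lam i * divdiff_sum lam e i k + divdiff_sum lam e i.+1 k.
  rewrite -[in RHS]divdiff_sum_first// -divdiff_sumZ -divdiff_sumD.
  by congr (divdiff_sum _ _ _ _); apply/funext => m; ring.
case: ifPn => [ik'|]; first by rewrite /C (big_ltn ik'); ring.
rewrite -leqNgt -/C => ki; rewrite [divdiff_sum _ _ i.+1 _]/divdiff_sum
  [X in _ + X]big_geq ?ltnS//; ring.
Qed.

(** * The backward equation from the rates at time 0 *)

Lemma nneseries_ge_two {R : realType} (u : nat -> R) i : (1 <= i)%N ->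
  (forall l, (1 <= l)%N -> 0 <= u l) ->
  ((u i + u i.+1)%:E <= \sum_(1 <= l <oo) (u l)%:E)%E.
Proof.
move=> i1 u0.
apply: (@le_trans _ _ (\sum_(1 <= l < i.+2) (u l)%:E)%E); last first.
  by apply: nneseries_lim_ge => l l1 _; rewrite lee_fin u0.
rewrite sumEFin lee_fin big_nat_recr//= big_nat_recr//= -addrA lerDr.
by rewrite big_nat_cond sumr_ge0// => l; rewrite andbT => /andP[l1 _]; exact: u0.
Qed.

Lemma transition_function_le1 {R : realType} (p : R -> nat -> nat -> R) t i j :
  transition_function p -> 0 <= t -> (1 <= i)%N -> (1 <= j)%N -> p t i j <= 1.
Proof.
move=> [p0 p1 _ _] t0 i1 j1.
rewrite -lee_fin -(p1 t i t0 i1).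
apply: (le_trans _ (nneseries_ge_two j1 _)).
  by rewrite lee_fin lerDl p0.
by move=> l l1; exact: p0.
Qed.

Lemma nneseriesD_from1 {R : realType} (f g : nat -> R) :
  (forall l, (1 <= l)%N -> 0 <= f l) -> (forall l, (1 <= l)%N -> 0 <= g l) ->
  (\sum_(1 <= l <oo) (f l + g l)%:E =
   \sum_(1 <= l <oo) (f l)%:E + \sum_(1 <= l <oo) (g l)%:E)%E.
Proof.
move=> f0 g0.
rewrite -nneseriesD//; last 2 first.
  by move=> l l1 _; rewrite lee_fin f0.
  by move=> l l1 _; rewrite lee_fin g0.
Qed.

(* The mass of row [i] of [p h] outside of [i] and [i.+1] is [o(h)], so that
   the Kolmogorov backward equation holds with a remainder uniform in [t]. *)
Lemma backward_increment {R : realType} (p : R -> nat -> nat -> R) h t i j :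
  transition_function p -> 0 <= h -> 0 <= t -> (1 <= i)%N -> (1 <= j)%N ->
  p h i i * p t i j + p h i i.+1 * p t i.+1 j <= p (h + t) i j <=
  p h i i * p t i j + p h i i.+1 * p t i.+1 j + (1 - p h i i - p h i i.+1).
Proof.
move=> tp h0 t0 i1 j1; have [p0 p1 _ ck] := tp.
have ple l : (1 <= l)%N -> p t l j <= 1.
  by move=> l1; exact: transition_function_le1.
have u0 l : (1 <= l)%N -> 0 <= p h i l * p t l j by move=> l1; rewrite mulr_ge0 ?p0.
have v0 l : (1 <= l)%N -> 0 <= p h i l * (1 - p t l j).
  by move=> l1; rewrite mulr_ge0 ?p0 ?subr_ge0 ?ple.
have V : (p (h + t) i j)%:E = (\sum_(1 <= l <oo) (p h i l * p t l j)%:E)%E by exact: ck.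
have lo := nneseries_ge_two i1 u0.
(* The upper bound is the lower bound for the complementary weights [1 - p t l j], subtracted from
   the total mass 1. *)
have hi := nneseries_ge_two i1 v0.
rewrite -V lee_fin in lo; rewrite lo/=.
have E := nneseriesD_from1 u0 v0.
have {}E : (1 = (p (h + t) i j)%:E + \sum_(1 <= l <oo) (p h i l * (1 - p t l j))%:E)%E.
  rewrite V -E -(p1 h i h0 i1); apply: eq_eseriesr => l _; congr EFin; ring.
move: hi E; case: (\sum_(1 <= l <oo) _)%E => [r| |]//=.
rewrite lee_fin => hi; rewrite -EFinD => -[E]; lra.
Qed.

Lemma backward_estimate {R : realType} (lam : nat -> R) (p : R -> nat -> nat -> R) i j :
  transition_function p -> has_birth_rates lam p -> (1 <= i)%N -> (1 <= j)%N ->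
  forall e, 0 < e -> exists2 r, 0 < r & forall h t, 0 < h < r -> 0 <= t ->
    `|p (h + t) i j - p t i j - h * (lam i * (p t i.+1 j - p t i j))| <= e * h.
Proof.
move=> tp br i1 j1 e e0; have [p0 _ _ _] := tp.
(* Four quarters: one for each of the entries [p h i i] and [p h i i.+1], and two for the remaining
   mass of the row, which is minus the sum of these two errors. *)
have e4 : 0 < e / 4 by rewrite divr_gt0.
have rate k : (1 <= k)%N -> exists2 r, 0 < r & forall h, 0 < h < r ->
    `|p h i k - (i == k)%:R - h * birth_rate lam i k| <= e / 4 * h.
  move=> k1; have /cvgrPdist_le/(_ _ e4) := br i k i1 k1.
  rewrite near_withinE => /nbhs_ballP[r /= r0 H]; exists r => // h /andP[h0 hr].
  have := H h; rewrite /ball/= sub0r normrN gtr0_norm// => /(_ hr h0).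
  rewrite -(ler_pM2r h0) => /(le_trans _); apply.
  rewrite -[X in _ <= _ * X](gtr0_norm h0) -normrM distrC.
  rewrite le_eqVlt; apply/orP; left; apply/eqP; congr `|_|.
  by move: (birth_rate lam i k) => b; field; rewrite gt_eqF.
have [r1 r10 H1] := rate i i1.
have [r2 r20 H2] := rate i.+1 (leqW i1).
exists (Num.min r1 r2); first by rewrite lt_min r10.
move=> h t /andP[h0]; rewrite lt_min => /andP[hr1 hr2] t0.
have := H1 h; rewrite h0 hr1 => /(_ isT).
have := H2 h; rewrite h0 hr2 => /(_ isT).
rewrite /birth_rate !eqxx (ltn_eqF (ltnSn i)).
rewrite -[true%:R]/(1 : R) -[false%:R]/(0 : R) => {}H2 {}H1.
have := backward_increment tp (ltW h0) t0 i1 j1.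
have := p0 t i j t0 i1 j1; have := transition_function_le1 tp t0 i1 j1.
have := p0 t i.+1 j t0 (leqW i1) j1.
have := transition_function_le1 tp t0 (leqW i1) j1.
move: H1 H2; rewrite !ler_norml.
move: (p (h + t) i j) (p h i i) (p h i i.+1) (p t i j) (p t i.+1 j) (lam i) => v a b x y l.
move=> /andP[a1 a2] /andP[b1 b2] y1 y0 x1 x0 /andP[v1 v2].
pose da := a - 1 + h * l; pose db := b - h * l.
have Ha : - (e / 4 * h) <= da * x <= e / 4 * h.
  have : - (e / 4 * h) <= da <= e / 4 * h by rewrite /da; apply/andP; split; lra.
  have eh : 0 < e / 4 * h by rewrite mulr_gt0.
  by move: (e / 4 * h) eh => c c0 /andP[d1 d2]; apply/andP; split; nra.
have Hb : - (e / 4 * h) <= db * y <= e / 4 * h.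
  have : - (e / 4 * h) <= db <= e / 4 * h by rewrite /db; apply/andP; split; lra.
  have eh : 0 < e / 4 * h by rewrite mulr_gt0.
  by move: (e / 4 * h) eh => c c0 /andP[d1 d2]; apply/andP; split; nra.
move: Ha Hb; rewrite /da /db => /andP[Ha1 Ha2] /andP[Hb1 Hb2].
apply/andP; split; lra.
Qed.

(** Only forward increments are controlled, but [r] and [L] are the same for all base points, so a
    backward increment is a forward one seen from its left end. *)
Definition lipschitz_increments {R : realType} (F : R -> R) : Prop :=
  exists2 r, 0 < r & exists2 L, 0 < L & forall h t, 0 < h < r -> 0 <= t ->
    `|F (h + t) - F t| <= L * h.

Lemma lipschitz_increments_right_cvg {R : realType} (F : R -> R) :
  lipschitz_increments F -> F x @[x --> 0^'+] --> F 0.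
Proof.
move=> [r r0 [L L0 H]]; apply/cvgrPdist_le => e e0; near=> x.
have x0 : 0 < x by near: x; exact: nbhs_right_gt.
have xr : x < r by near: x; exact: nbhs_right_lt.
have xe : x < e / L by near: x; apply: nbhs_right_lt; rewrite divr_gt0.
have := H x 0; rewrite x0 xr addr0 => /(_ isT (lexx 0)).
rewrite distrC => /le_trans; apply.
by rewrite mulrC -ler_pdivlMr// ltW.
Unshelve. all: by end_near. Qed.

(** For [h < 0] the forward estimate is applied at [h + t] with step [- h]. It involves [g (h + t)]
    instead of [g t], and the Lipschitz bound absorbs the difference, half of [e] being reserved for
    it. *)
Lemma is_derive_of_increments {R : realType} (F g : R -> R) (t : R) : 0 < t ->
  (forall e, 0 < e -> exists2 r, 0 < r & forall h t, 0 < h < r -> 0 <= t ->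
    `|F (h + t) - F t - h * g t| <= e * h) ->
  lipschitz_increments g -> is_derive t 1 F (g t).
Proof.
move=> t0 HF [rg rg0 [L L0 Hg]].
have H : h^-1 *: ((F \o shift t) (h *: 1) - F t) @[h --> 0^'] --> g t.
  apply/cvgrPdist_le => e e0.
  have e2 : 0 < e / 2 by rewrite divr_gt0.
  have [r r0 Hr] := HF (e / 2) e2.
  near=> h.
  have hN0 : h != 0 by near: h; exact: nbhs_dnbhs_neq.
  have hr : `|h| < r by near: h; exact: dnbhs0_lt.
  have hrg : `|h| < rg by near: h; exact: dnbhs0_lt.
  have ht : `|h| < t by near: h; exact: dnbhs0_lt.
  have hL : `|h| < e / (2 * L) by near: h; apply: dnbhs0_lt; rewrite divr_gt0// mulr_gt0.
  rewrite /shift/= /GRing.scale/= mulr1.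
  have -> : g t - h^-1 * (F (h + t) - F t) = - (h^-1 * (F (h + t) - F t - h * g t)).
    by field.
  rewrite normrN normrM normfV ler_pdivrMl ?normr_gt0// [`|h| * e]mulrC.
  have [h0|h0] := ltP 0 h.
    rewrite (gtr0_norm h0) in hr *.
    have := Hr h t; rewrite h0 hr (ltW t0) => /(_ isT isT)/le_trans; apply.
    by rewrite ler_wpM2r ?(ltW h0)// ler_pdivrMr// ler_pMr// ler1n.
  have {}h0 : 0 < - h by rewrite oppr_gt0 lt_neqAle hN0.
  have nh : `|h| = - h by rewrite -normrN gtr0_norm.
  rewrite nh in hr hrg ht hL *.
  have t'0 : 0 <= h + t by rewrite -[h]opprK addrC subr_ge0 ltW.
  have := Hr (- h) (h + t); rewrite h0 hr addKr => /(_ isT t'0).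
  have := Hg (- h) (h + t); rewrite h0 hrg addKr => /(_ isT t'0).
  rewrite ltr_pdivlMr ?mulr_gt0// in hL.
  move: h0 hL; move: (F (h + t)) (F t) (g t) (g (h + t)) => a b c d.
  rewrite -[h in h * c]opprK; move: (- h) => k k0 hL.
  rewrite !ler_norml => /andP[c1 c2] /andP[d1 d2].
  have kL : k * (L * k) <= k * (e / 2).
    by rewrite ler_pM2l//; lra.
  apply/andP; split; nra.
apply: DeriveDef; first by apply/cvg_ex; eexists; exact: H.
exact: cvg_lim H.
Unshelve. all: by end_near. Qed.

Lemma is_derive_ge0_le {R : realType} (f df : R -> R) :
  (forall t : R, 0 < t -> is_derive t 1 f (df t)) -> f x @[x --> 0^'+] --> f 0 ->
  (forall t, 0 < t -> 0 <= df t) -> forall t, 0 <= t -> f 0 <= f t.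
Proof.
move=> fd f0 df0 t; rewrite le_eqVlt => /predU1P[<-//|t0].
have cf x : 0 < x -> {for x, continuous f}.
  by move=> x0; have ? := fd x x0; exact: is_derive_continuous.
have [||c] := @MVT R f df 0 t t0.
- by move=> x; rewrite in_itv/= => /andP[x0 _]; exact: fd.
- apply/continuous_within_itvP => //; split => //.
    by move=> x; rewrite in_itv/= => /andP[x0 _]; exact: cf.
  by apply: cvg_at_left_filter; exact: cf.
rewrite in_itv/= subr0 => /andP[c0 _] E.
by rewrite -subr_ge0 E mulr_ge0 ?df0// ltW.
Qed.

Lemma is_derive0_cst {R : realType} (f : R -> R) :
  (forall t : R, 0 < t -> is_derive t 1 f 0) -> f x @[x --> 0^'+] --> f 0 ->
  forall t, 0 <= t -> f t = f 0.
Proof.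
move=> fd f0 t t0; apply/eqP; rewrite eq_le; apply/andP; split.
  rewrite -lerN2; apply: (@is_derive_ge0_le _ (\- f) (cst 0)) => //.
    move=> x x0; have ? := fd x x0.
    by apply: is_derive_eq; rewrite oppr0.
  exact: cvgN.
exact: (@is_derive_ge0_le _ f (cst 0)).
Qed.

(** * Determination of the transition probabilities *)

Section birth_transition.
Context {R : realType} (lam : nat -> R) (p : R -> nat -> nat -> R).
Hypothesis lam0 : forall k, (1 <= k)%N -> 0 < lam k.
Hypothesis tp : transition_function p.
Hypothesis br : has_birth_rates lam p.

Let p0 t i j : 0 <= t -> (1 <= i)%N -> (1 <= j)%N -> 0 <= p t i j.
Proof. by case: tp => + _ _ _; exact. Qed.

Let p1 t i j : 0 <= t -> (1 <= i)%N -> (1 <= j)%N -> p t i j <= 1.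
Proof. exact: transition_function_le1. Qed.

Let pz i j : (1 <= i)%N -> (1 <= j)%N -> p 0 i j = (i == j)%:R.
Proof. by case: tp => _ _ + _; exact. Qed.

Lemma lipschitz_transition i j : (1 <= i)%N -> (1 <= j)%N ->
  lipschitz_increments (fun t => p t i j).
Proof.
move=> i1 j1; have [r r0 H] := backward_estimate tp br i1 j1 ltr01.
have l0 := lam0 i1.
exists r => //; exists (lam i + 1); first by rewrite addr_gt0.
move=> h t hr t0; have /andP[h0 _] := hr; have := H h t hr t0.
have := p0 t0 i1 j1; have := p1 t0 i1 j1.
have := p0 t0 (leqW i1) j1; have := p1 t0 (leqW i1) j1.
move: (p _ _ _) (p _ _ _) (p _ _ _) => x y z.
move=> a1 a2 a3 a4; rewrite !ler_norml => /andP[b1 b2].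
have : - (lam i * h) <= h * (lam i * (y - z)) <= lam i * h.
  by have lh := mulr_gt0 l0 h0; apply/andP; split; nra.
by move=> /andP[c1 c2]; apply/andP; split; lra.
Qed.

Lemma backward_equation i j (t : R) : (1 <= i)%N -> (1 <= j)%N -> 0 < t ->
  is_derive t 1 (fun t => p t i j) (lam i * (p t i.+1 j - p t i j)).
Proof.
move=> i1 j1 t0.
apply: (@is_derive_of_increments R (fun t => p t i j)
  (fun t => lam i * (p t i.+1 j - p t i j))) => //.
  exact: backward_estimate.
have [r r0 [L L0 HL]] := lipschitz_transition i1 j1.
have [r' r'0 [L' L'0 HL']] := lipschitz_transition (leqW i1) j1.
have l0 := lam0 i1.
exists (Num.min r r'); first by rewrite lt_min r0.
exists (lam i * (L' + L)); first by rewrite mulr_gt0// addr_gt0.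
move=> h s /andP[h0]; rewrite lt_min => /andP[hr hr'] s0.
have := HL h s; rewrite h0 hr => /(_ isT s0) A.
have := HL' h s; rewrite h0 hr' => /(_ isT s0) B.
have -> : lam i * (p (h + s) i.+1 j - p (h + s) i j) - lam i * (p s i.+1 j - p s i j) =
  lam i * ((p (h + s) i.+1 j - p s i.+1 j) - (p (h + s) i j - p s i j)) by ring.
rewrite normrM gtr0_norm// -mulrA ler_pM2l// (le_trans (ler_normB _ _))//.
by rewrite mulrDl lerD.
Qed.

(* Comparison with the exponential solution: a bound of [e^(-t) p_(i+1,j)]
   improves to [e^(-t) p_(i,j)] by the factor [1 + 1 / lam i]. *)
Lemma below_diagonal_step i j S : (1 <= j)%N -> (j < i)%N -> 0 <= S ->
  (forall t, 0 <= t -> p t i.+1 j <= S * expR t) ->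
  forall t, 0 <= t -> (1 + (lam i)^-1) * p t i j <= S * expR t.
Proof.
move=> j1 ji S0 HS t t0.
have i1 : (1 <= i)%N by exact: leq_trans (ltnW ji).
have l0 := lam0 i1.
(* With the integrating factor [e^(lam i t)], the backward equation makes [df] the derivative of
   [f]; [HS] makes it nonnegative, and [f 0 >= 0] because [p 0 i j = 0] below the diagonal. *)
pose f t := S * (lam i / (lam i + 1)) * expR ((lam i + 1) * t) - expR (lam i * t) * p t i j.
pose df t := lam i * expR (lam i * t) * (S * expR t - p t i.+1 j).
have fd (s : R) : 0 < s -> is_derive s 1 f (df s).
  move=> s0; have ? := backward_equation i1 j1 s0.
  apply: is_derive_eq; rewrite /df /GRing.scale/= mulrDl mul1r expRD.
  field; rewrite gt_eqF// ?addr_gt0//.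
have f0 : f x @[x --> 0^'+] --> f 0.
  apply: cvgB.
    apply: cvgMr; apply: cvg_at_right_filter.
    have ? : is_derive (0 : R) 1 (fun x => expR ((lam i + 1) * x))
      ((lam i + 1) * expR ((lam i + 1) * 0)).
      by apply: is_derive_eq; rewrite /GRing.scale/=; ring.
    exact: is_derive_continuous.
  apply: cvgM; last exact: lipschitz_increments_right_cvg (lipschitz_transition i1 j1).
  apply: cvg_at_right_filter.
  have ? : is_derive (0 : R) 1 (fun x => expR (lam i * x)) (lam i * expR (lam i * 0)).
    by apply: is_derive_eq; rewrite /GRing.scale/=; ring.
  exact: is_derive_continuous.
have df0 s : 0 < s -> 0 <= df s.
  move=> s0; rewrite /df !mulr_ge0 ?expR_ge0 ?(ltW l0)// subr_ge0.
  by apply: HS; exact: ltW.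
have := is_derive_ge0_le fd f0 df0 t0.
rewrite /f !mulr0 expR0 pz// (gtn_eqF ji) mulr0 subr0 mulr1 mulrDl mul1r expRD.
have ll : 0 < lam i / (lam i + 1) by rewrite divr_gt0// addr_gt0.
move=> H.
have : 0 <= expR (lam i * t) * (S * (lam i / (lam i + 1)) * expR t - p t i j).
  have := mulr_ge0 S0 (ltW ll); lra.
rewrite pmulr_rge0 ?expR_gt0// subr_ge0 => {}H.
have -> : 1 + (lam i)^-1 = (lam i / (lam i + 1))^-1.
  by field; rewrite !gt_eqF// addr_gt0.
by rewrite ler_pdivrMl// mulrCA mulrA.
Qed.

Hypothesis lam_sum : (\sum_(1 <= k <oo) (lam k)^-1%:E = +oo)%E.

(** Iterating [below_diagonal_step] from the trivial bound [p <= 1 <= e^s] gives a factor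
    [1 + 1 / lam l] for each state passed. If [p t i j] were positive, these products would be
    bounded, hence also the partial sums of [1 / lam l], against the divergence. *)
Lemma transition_below_diagonal i j t : (1 <= j)%N -> (j < i)%N -> 0 <= t ->
  p t i j = 0.
Proof.
move=> j1 ji t0; have i1 : (1 <= i)%N by exact: leq_trans (ltnW ji).
have key n : forall a, (j < a)%N -> forall s, 0 <= s ->
    \prod_(a <= l < a + n) (1 + (lam l)^-1) * p s a j <= expR s.
  elim: n => [|n IH] a ja s s0.
    rewrite addn0 big_geq// mul1r; apply: (@le_trans _ _ 1).
      by apply: p1 => //; exact: leq_trans (ltnW ja).
    by rewrite -expR0 ler_expR.
  have a1 : (1 <= a)%N by exact: leq_trans (ltnW ja).
  have aan : (a < a + n.+1)%N by rewrite -[X in (X < _)%N]addn0 ltn_add2l.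
  rewrite (big_ltn aan) addnS -addSn.
  set Q := \prod_(_ <= _ < _) _.
  have Q0 : 0 < Q.
    rewrite /Q big_nat_cond prodr_gt0// => l; rewrite andbT => /andP[al _].
    by rewrite addr_gt0// invr_gt0 lam0// (leq_trans _ al).
  rewrite mulrAC mulrC -ler_pdivlMl//.
  apply: (@below_diagonal_step a j Q^-1) => //; first by rewrite invr_ge0 ltW.
  by move=> u u0; rewrite ler_pdivlMl//; apply: IH => //; exact: ltnW.
apply/eqP; rewrite eq_le p0// andbT leNgt; apply/negP => pt0.
have bnd n : \sum_(i <= l < i + n) (lam l)^-1 <= expR t / p t i j.
  rewrite ler_pdivlMr//; apply: le_trans (key n i ji t t0).
  rewrite ler_pM2r//; elim: n => [|n IH]; first by rewrite addn0 !big_geq.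
  rewrite addnS !big_nat_recr ?leq_addr//=.
  have ln : 0 < (lam (i + n)%N)^-1 by rewrite invr_gt0 lam0// (leq_trans i1)// leq_addr.
  have P1 : 1 <= \prod_(i <= l < i + n) (1 + (lam l)^-1).
    rewrite big_nat_cond; elim/big_ind: _ => [//|x y x1 y1|l]; first exact: mulr_ege1.
    rewrite andbT => /andP[il _]; by rewrite lerDl invr_ge0 ltW// lam0// (leq_trans _ il).
  by nra.
have fin : (\sum_(1 <= k <oo) (lam k)^-1%:E <=
    (\sum_(1 <= k < i) (lam k)^-1 + expR t / p t i j)%:E)%E.
  apply: lime_le.
    by apply: is_cvg_nneseries => k k1 _; rewrite lee_fin invr_ge0 ltW// lam0.
  near=> n; have ni : (i <= n)%N by near: n; exists i.
  rewrite sumEFin lee_fin (big_cat_nat i1 ni)/= lerD2l.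
  by have := bnd (n - i)%N; rewrite subnKC.
by move: fin; rewrite lam_sum leye_eq.
Unshelve. all: by end_near. Qed.

Hypothesis lam_inj : forall i j, (1 <= i)%N -> (1 <= j)%N -> lam i = lam j -> i = j.

(** Downward induction on the initial state with [k] fixed. At [a = k] the term from [k.+1] vanishes
    by [transition_below_diagonal]. If rows [a.+1] agree, the difference of rows [a] times
    [e^(lam a s)] has derivative 0 and starts at 0. *)
Lemma transition_birth_prob i k t : (1 <= i)%N -> (i <= k)%N -> 0 <= t ->
  p t i k = birth_prob lam i k t.
Proof.
move=> i1 ik t0.
have k1 : (1 <= k)%N by exact: leq_trans ik.
have inj i' : (1 <= i')%N -> forall a b, (i' <= a)%N -> (i' <= b)%N -> lam a = lam b -> a = b.
  by move=> i'1 a b ia ib; apply: lam_inj; exact: leq_trans i'1 _.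
have step a : (1 <= a)%N -> (a <= k)%N ->
    (forall s, 0 <= s -> lam a * p s a.+1 k =
      if (a < k)%N then lam a * birth_prob lam a.+1 k s else 0) ->
    forall s, 0 <= s -> p s a k = birth_prob lam a k s.
  move=> a1 ak next s s0.
  pose f s := expR (lam a * s) * (p s a k - birth_prob lam a k s).
  have fd (u : R) : 0 < u -> is_derive u 1 f 0.
    move=> u0; have ? := backward_equation a1 k1 u0.
    have ? := is_derive_birth_prob u (inj a a1) ak.
    apply: is_derive_eq; rewrite /GRing.scale/= -(next u (ltW u0)); ring.
  have f0 : f x @[x --> 0^'+] --> f 0.
    apply: cvgM.
      apply: cvg_at_right_filter.
      have ? : is_derive (0 : R) 1 (fun x => expR (lam a * x)) (lam a * expR (lam a * 0)).
        by apply: is_derive_eq; rewrite /GRing.scale/=; ring.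
      exact: is_derive_continuous.
    apply: cvgB; first exact: lipschitz_increments_right_cvg (lipschitz_transition a1 k1).
    apply: cvg_at_right_filter.
    exact: is_derive_continuous (is_derive_birth_prob 0 (inj a a1) ak).
  have := is_derive0_cst fd f0 s0; rewrite /f pz// birth_prob0//; last exact: inj.
  rewrite subrr mulr0 => /eqP; rewrite mulf_eq0 gt_eqF ?expR_gt0//= subr_eq0.
  by move=> /eqP.
have H n : forall a, (1 <= a)%N -> (a + n = k)%N -> forall s, 0 <= s ->
    p s a k = birth_prob lam a k s.
  elim: n => [|n IH] a a1 ank s s0.
    have ak : a = k by rewrite -ank addn0.
    apply: step => // [|u u0]; first by rewrite ak.
    by rewrite ak ltnn transition_below_diagonal ?mulr0.
  have ak : (a < k)%N by rewrite -ank -[X in (X < _)%N]addn0 ltn_add2l.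
  apply: step => // [|u u0]; first exact: ltnW.
  by rewrite ak IH// addSnnS.
by apply: (H (k - i)%N) => //; rewrite subnKC.
Qed.

End birth_transition.

Lemma probability_setI1 {R : realType} {d} {T : measurableType d}
    (P : probability T R) (A B : set T) : measurable A -> measurable B ->
  P A = 1%E -> P (A `&` B) = P B.
Proof.
move=> mA mB PA; have PC : P (~` A) = 0%E by rewrite probability_setC// PA subee.
rewrite -[in RHS](setIT B) -(setUv A) setIUr measureU//.
- rewrite setIC [X in (_ + X)%E](_ : _ = 0%E) ?adde0//; apply/eqP.
  rewrite eq_le measure_ge0 andbT -PC le_measure ?inE//.
    by apply: measurableI => //; exact: measurableC.
  exact: measurableC.
- exact: measurableI.
- by apply: measurableI => //; exact: measurableC.
- by rewrite setICA -setIA setICr !setI0.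
Qed.

Lemma pure_birth_law {R : realType} {d} {T : measurableType d} {P : probability T R}
    (lam : nat -> R) (N : R -> {RV P >-> nat}) s k :
  (forall k, (1 <= k)%N -> 0 < lam k) ->
  (forall i j, (1 <= i)%N -> (1 <= j)%N -> lam i = lam j -> i = j) ->
  (\sum_(1 <= k <oo) (lam k)^-1%:E = +oo)%E ->
  pure_birth_process lam N -> 0 <= s -> (1 <= k)%N ->
  P [set w | N s w = k] = (birth_prob lam 1 k s)%:E.
Proof.
move=> lam0 inj lsum [_ N0 [p [tp br mp]]] s0 k1.
have mN u m : measurable [set w | N u w = m].
  have := measurable_funPT (N u) measurableT [set m].
  by rewrite setTI => /(_ I).
(* The Markov property at the two times 0 and [s] with the states 1 and [k]; the event at time 0 has
   probability 1. *)
have := mp 0%N (fun i => if i is 0%N then 0 else s) (fun i => if i is 0%N then 1%N else k).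
move=> /(_ (lexx 0)) /=.
have nd : nondecreasing_seq (fun i : nat => if i is 0%N then 0 else s).
  by move=> [|a] [|b].
have k01 (i : nat) : (1 <= if i is 0%N then 1 else k)%N by case: i.
move=> /(_ nd k01).
have -> : \bigcap_(i < 2) [set w | N (if i is 0%N then 0 else s) w =
    (if i is 0%N then 1%N else k)] = [set w | N 0 w = 1%N] `&` [set w | N s w = k].
  apply/seteqP; split=> w /=; first by move=> H; split; [exact: (H 0%N)|exact: (H 1%N)].
  by move=> [H0 H1] [|[|i]].
have -> : \bigcap_(i < 1) [set w | N (if i is 0%N then 0 else s) w =
    (if i is 0%N then 1%N else k)] = [set w | N 0 w = 1%N].
  apply/seteqP; split=> w /=; first by move=> H; exact: (H 0%N).
  by move=> H0 [|i].
rewrite N0 mul1e subr0 probability_setI1// => ->.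
by rewrite (transition_birth_prob lam0 tp br lsum inj).
Qed.

(** * Subordination to an independent random time *)

Lemma mutually_independent2 {R : realType} {d} {T : measurableType d}
    {P : probability T R} (F G : set (set T)) A B :
  mutually_independent P [:: F; G] -> F A -> G B -> P (A `&` B) = (P A * P B)%E.
Proof.
move=> ind FA GB; have := ind (fun i => if i is 0%N then A else B).
move=> /(_ _)/= H.
rewrite big_ord_recl big_ord1/= in H.
have <- := H _.
  congr (P _); apply/seteqP; split=> w /=.
    by move=> [Aw Bw] [|[|i]].
  by move=> Hw; split; [exact: (Hw 0%N)|exact: (Hw 1%N)].
by move=> [|[|i]].
Qed.

Lemma mutually_independent3 {R : realType} {d} {T : measurableType d}
    {P : probability T R} (F G H : set (set T)) A B C :
  mutually_independent P [:: F; G; H] -> F A -> G B -> H C ->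
  P (A `&` B `&` C) = (P A * P B * P C)%E.
Proof.
move=> ind FA GB HC; have := ind (fun i => if i is 0%N then A else if i is 1%N then B else C).
move=> /(_ _)/= E.
rewrite 2!big_ord_recl big_ord1/= muleA in E.
have <- := E _.
  congr (P _); apply/seteqP; split=> w /=.
    by move=> [[Aw Bw] Cw] [|[|[|i]]].
  by move=> Hw; split; [split; [exact: (Hw 0%N)|exact: (Hw 1%N)]|exact: (Hw 2%N)].
by move=> [|[|[|i]]].
Qed.

Lemma sub_sigma_process {R : realType} {d d'} {T : measurableType d}
    {E : measurableType d'} (X : R -> T -> E) :
  (forall t, measurable_fun setT (X t)) -> sigma_process X `<=` measurable.
Proof.
move=> mX; apply: smallest_sub; first exact: sigma_algebra_measurable.
move=> A [t _ [B mB <-]]; exact: mX.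
Qed.

Lemma subordination {R : realType} {d d'} {T : measurableType d}
    {E : measurableType d'} (P Q : probability T R) (X : R -> T -> E)
    (tau : T -> R) (f : E -> \bar R) :
  (forall t, measurable_fun setT (X t)) -> measurable_process X ->
  measurable_fun setT tau -> (forall w, 0 <= tau w) ->
  (forall A B, measurable A -> sigma_process X B ->
    Q (tau @^-1` A `&` B) = (P (tau @^-1` A) * Q B)%E) ->
  measurable_fun setT (fun w => X (tau w) w) /\
  (measurable_fun setT f -> (forall x, (0 <= f x)%E) ->
   measurable_fun setT (fun w => \int[Q]_v f (X (tau w) v))%E /\
   (\int[Q]_w f (X (tau w) w) = \int[P]_w \int[Q]_v f (X (tau w) v))%E).
Proof.
move=> mX mpX mtau tau0 ind.
pose S := g_sigma_algebraType (process_events X).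
have mid : measurable_fun setT (id : T -> S).
  by move=> _ A mA; rewrite setTI; exact: (sub_sigma_process mX).
have mpsi : measurable_fun setT (fun w : T => (tau w, (w : S))).
  exact: (measurable_fun_pair mtau mid).
have mD : measurable [set z : R * S | 0 <= z.1].
  rewrite (_ : [set z : R * S | 0 <= z.1] = fst @^-1` `[0%R, +oo[%classic).
    by rewrite -[X in measurable X]setTI; apply: measurable_fst => //; exact: measurable_itv.
  by apply/seteqP; split=> z /=; rewrite in_itv/= andbT.
split.
  have H : measurable_fun setT ((fun z : R * S => X z.1 z.2) \o (fun w : T => (tau w, (w : S)))).
    apply: (measurable_comp mD _ mpX mpsi).
    by move=> _ [w _ <-] /=.
  exact: H.
move=> mf f0.
pose tauP : {mfun T >-> R} := HB.pack tau (isMeasurableFun.Build _ _ _ _ tau mtau).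
pose idQ : {mfun T >-> S} := HB.pack (id : T -> S)
  (isMeasurableFun.Build _ _ _ _ (id : T -> S) mid).
pose psiQ : {mfun T >-> (R * S)%type} := HB.pack (fun w : T => (tau w, (w : S)))
   (isMeasurableFun.Build _ _ _ _ (fun w : T => (tau w, (w : S))) mpsi).
pose F (z : R * S) : \bar R := ((fun z : R * S => f (X z.1 z.2)) \_ [set z : R * S | 0 <= z.1]) z.
have mF : measurable_fun setT F.
  apply/(measurable_restrictT _ mD).
  exact: (measurableT_comp mf mpX).
have F0 z : (0 <= F z)%E by rewrite /F patchE; case: ifP.
have FE s v : 0 <= s -> F (s, v) = f (X s v) by move=> s0; rewrite /F patchE mem_set.
have FQ w : fubini_F (distribution Q idQ) F (tau w) = (\int[Q]_v f (X (tau w) v))%E.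
  rewrite /fubini_F.
  rewrite (@ge0_integral_distribution _ _ _ _ _ Q idQ (fun v => F (tau w, v)))//.
  - by apply: eq_integral => v _ /=; rewrite FE.
  - exact: measurableT_comp mF (measurable_pair1 _).
split.
  under eq_fun do rewrite -FQ.
  have mG := @measurable_fun_fubini_tonelli_F _ _ _ _ R (distribution Q idQ) F mF F0.
  exact: (measurableT_comp mG mtau).
transitivity (\int[distribution Q psiQ]_z F z)%E.
  rewrite (@ge0_integral_distribution _ _ _ _ _ Q psiQ F)//.
  by apply: eq_integral => w _ /=; rewrite FE.
transitivity (\int[distribution P tauP \x distribution Q idQ]_z F z)%E.
  apply: eq_measure_integral => A mA _.
  apply/esym/product_measure_unique => // B C mB mC; exact: (ind B C mB mC).
rewrite fubini_tonelli1//.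
rewrite (@ge0_integral_distribution _ _ _ _ _ P tauP)//; last 2 first.
- exact: measurable_fun_fubini_tonelli_F.
- by move=> s; apply: integral_ge0 => v _.
by apply: eq_integral => w _ /=; exact: FQ.
Qed.

Lemma integral_indic_comp {R : realType} {d d'} {T : measurableType d}
    {E : measurableType d'} (Q : probability T R) (X : T -> E) (D : set E) :
  measurable_fun setT X -> measurable D ->
  (\int[Q]_w (\1_D (X w))%:E = Q (X @^-1` D))%E.
Proof.
move=> mX mD; have mXD : measurable (X @^-1` D) by rewrite -[X in measurable X]setTI; exact: mX.
by rewrite -[in RHS](setIT (X @^-1` D)) -integral_indic.
Qed.

(* [subordination] for the conditional probability given [C]. *)
Lemma subordination_indep {R : realType} {d d'} {T : measurableType d}
    {E : measurableType d'} (P : probability T R) (X : R -> T -> E)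
    (tau : T -> R) (C : set T) (D : set E) :
  (forall t, measurable_fun setT (X t)) -> measurable_process X ->
  measurable_fun setT tau -> (forall w, 0 <= tau w) -> measurable C ->
  (forall A B, measurable A -> sigma_process X B ->
    P (tau @^-1` A `&` B) = (P (tau @^-1` A) * P B)%E) ->
  (forall A B, measurable A -> sigma_process X B ->
    P (tau @^-1` A `&` B `&` C) = (P (tau @^-1` A) * P B * P C)%E) ->
  measurable D ->
  P ((fun w => X (tau w) w) @^-1` D `&` C) =
  (P ((fun w => X (tau w) w) @^-1` D) * P C)%E.
Proof.
move=> mX mpX mtau tau0 mC ind indC mD.
pose f (x : E) : \bar R := (\1_D x)%:E.
have mf : measurable_fun setT f by apply/measurable_EFinP; exact: measurable_indic.
have f0 x : (0 <= f x)%E by rewrite lee_fin.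
have [mZ HP] := subordination f mX mpX mtau tau0 ind.
(* Conditioning requires [P C > 0]; otherwise both sides are 0. *)
have [PC0|PC0] := eqVneq (P C) 0%E.
  rewrite PC0 mule0; apply/eqP; rewrite eq_le measure_ge0 andbT -PC0.
  apply: le_measure; rewrite ?inE//.
  by apply: measurableI => //; rewrite -[X in measurable X]setTI; exact: mZ.
have PCfin : P C \is a fin_num by exact: fin_num_measure.
pose c := fine (P C).
have c0 : 0 < c.
  by rewrite fine_gt0// ltey_eq PCfin/= lt0e PC0 measure_ge0.
have cE : P C = c%:E by rewrite fineK.
pose r := NngNum (ltW (eqbRL (invr_gt0 c) c0)).
have QT : mscale r (mrestr P mC) setT = 1%E.
  by rewrite /mscale/= /mrestr setTI cE -EFinM mulVf// gt_eqF.
pose Q : probability T R := HB.pack (mscale r (mrestr P mC))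
  (Measure_isProbability.Build _ _ _ (mscale r (mrestr P mC)) QT).
have QE A : Q A = (c^-1%:E * P (A `&` C))%E by [].
have QP B : sigma_process X B -> Q B = P B.
  move=> sB; have := indC setT B measurableT sB.
  rewrite preimage_setT setTI probability_setT mul1e QE => ->.
  by rewrite cE muleC -muleA -EFinM divff ?mule1// gt_eqF.
have indQ A B : measurable A -> sigma_process X B ->
    Q (tau @^-1` A `&` B) = (P (tau @^-1` A) * Q B)%E.
  move=> mA sB; rewrite QE indC// QP// cE muleC -muleA -EFinM divff ?mule1//.
  by rewrite gt_eqF.
have [_ HQ] := subordination f mX mpX mtau tau0 indQ.
have sX s : 0 <= s -> sigma_process X (X s @^-1` D).
  move=> s0; apply: sub_sigma_algebra; exists s => //=.
  by exists D => //; rewrite setTI.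
(* Both measures average over the law of [tau] under [P], and each [X s] has the same law under [Q]
   as under [P]. *)
have : Q ((fun w => X (tau w) w) @^-1` D) = P ((fun w => X (tau w) w) @^-1` D).
  rewrite -!integral_indic_comp// (HQ mf f0).2 (HP mf f0).2; apply: eq_integral => w _.
  by rewrite !integral_indic_comp// QP//; exact: sX.
by rewrite QE => <-; rewrite cE muleC muleA -EFinM divff ?mul1e// gt_eqF.
Qed.

(** * State probabilities of the composed processes *)

Lemma fractional_birth_prob1 {R : realType} (lam : nat -> R) b t :
  fractional_birth_prob lam b 1 t = mittag_leffler b (- lam 1%N * t `^ b).
Proof.
rewrite /fractional_birth_prob big_geq// mul1r big_nat1 big_mkcond/= big_nat1.
by rewrite eqxx/= divr1.
Qed.

Lemma birth_probE {R : realType} (lam : nat -> R) k (s : R) : 0 <= s ->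
  birth_prob lam 1 k s = fractional_birth_prob lam 1 k s.
Proof.
move=> s0; congr (_ * _); apply: eq_bigr => m _.
by rewrite mittag_leffler1 powRr1.
Qed.

Lemma integral_divdiff_sum {R : realType} {d} {T : measurableType d}
    {P : probability T R} (x : nat -> R) (F : nat -> T -> R) (c : nat -> R) a k :
  (forall m, (1 <= m)%N -> P.-integrable setT (fun w => (F m w)%:E) /\
     \int[P]_w (F m w)%:E = (c m)%:E)%E ->
  (\int[P]_w (a * divdiff_sum x (fun m => F m w) 1 k)%:E =
   (a * divdiff_sum x c 1 k)%:E)%E.
Proof.
move=> Fc; pose g m : R := a / \prod_(1 <= l < k.+1 | l != m.+1) (x l - x m.+1).
have E (f : nat -> R) : ((a * divdiff_sum x f 1 k)%:E =
    \sum_(0 <= m < k) (g m)%:E * (f m.+1)%:E)%E.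
  rewrite /divdiff_sum big_add1/= mulr_sumr -sumEFin; apply: eq_bigr => m _.
  by rewrite -EFinM /g mulrA mulrAC.
under eq_integral do rewrite E.
rewrite E integral_sum//; last by move=> m; apply: integrableZl => //; exact: (Fc _ _).1.
by apply: eq_bigr => m _; have [iF <-] := Fc m.+1 isT; rewrite integralZl.
Qed.

(** The time [tau] enters only through its averages of Mittag-Leffler functions. This covers order
    [nu] at [Talpha], and order 1 both at the composed time and at [Tnualpha]. *)
Lemma subordinated_birth_law {R : realType} {d} {T : measurableType d}
    (P : probability T R) (lam : nat -> R) (b b' t : R) (X : R -> {RV P >-> nat})
    (tau : T -> R) k :
  measurable_process X -> measurable_fun setT tau -> (forall w, 0 <= tau w) ->
  (forall A B, measurable A -> sigma_process X B ->
    P (tau @^-1` A `&` B) = (P (tau @^-1` A) * P B)%E) ->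
  (forall m, (1 <= m)%N -> 0 < lam m) ->
  (forall s k, 0 <= s -> (1 <= k)%N ->
    P [set w | X s w = k] = (fractional_birth_prob lam b k s)%:E) ->
  (forall l, 0 < l ->
    P.-integrable setT (fun w => (mittag_leffler b (- l * tau w `^ b))%:E) /\
    (\int[P]_w (mittag_leffler b (- l * tau w `^ b))%:E =
     (mittag_leffler b' (- l * t `^ b'))%:E)%E) ->
  (1 <= k)%N ->
  P [set w | X (tau w) w = k] = (fractional_birth_prob lam b' k t)%:E.
Proof.
move=> mpX mtau tau0 ind lam0 lawX ml k1.
have mX s : measurable_fun setT (X s) by exact: measurable_funPT.
pose f (n : nat) : \bar R := (\1_[set k] n)%:E.
have mf : measurable_fun setT f by apply/measurable_EFinP; exact: measurable_indic.
have f0 x : (0 <= f x)%E by rewrite lee_fin.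
have [mZ /(_ mf f0)[_ H]] := subordination f mX mpX mtau tau0 ind.
have <- : (\int[P]_w f (X (tau w) w) = P [set w | X (tau w) w = k])%E.
  exact: integral_indic_comp.
rewrite H; under eq_integral => w _.
  rewrite integral_indic_comp//.
  rewrite (_ : X (tau w) @^-1` [set k] = [set v | X (tau w) v = k])//.
  rewrite lawX//; over.
apply: (@integral_divdiff_sum _ _ _ _ _
  (fun m w => mittag_leffler b (- lam m * tau w `^ b))
  (fun m => mittag_leffler b' (- lam m * t `^ b'))).
by move=> m m1; apply: ml; exact: lam0.
Qed.

Lemma eq_law_pos_nat {R : realType} {d} {T : measurableType d}
    (P : probability T R) (X Y : T -> nat) :
  measurable_fun setT X -> measurable_fun setT Y ->
  (forall w, (1 <= X w)%N) -> (forall w, (1 <= Y w)%N) ->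
  (forall k, (1 <= k)%N -> P [set w | X w = k] = P [set w | Y w = k]) ->
  eq_law P X Y.
Proof.
move=> mX mY X1 Y1 XY; split => // A _; rewrite /pushforward.
have E (Z : T -> nat) : measurable_fun setT Z -> P (Z @^-1` A) =
    (\sum_(0 <= k <oo | k \in A) P [set w | Z w = k])%E.
  move=> mZ; rewrite -measure_bigcup//=.
  - congr (P _); apply/seteqP; split=> w /=; first by exists (Z w).
    by move=> [k Ak /= ->].
  - by move=> k _; rewrite -[X in measurable X]setTI; exact: (mZ measurableT [set k]).
  - by move=> i j _ _ [w [/= <- <-]].
(* State 0 belongs to the index set but is never visited, so both of its preimages are empty. *)
rewrite !E//; apply: eq_eseriesr => -[_|k _]; last exact: XY.
have N0 (Z : T -> nat) : (forall w, (1 <= Z w)%N) -> [set w | Z w = 0%N] = set0.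
  by move=> Z1; apply/seteqP; split=> w //= Zw; have := Z1 w; rewrite Zw.
by rewrite !N0.
Qed.

Lemma integral_mittag_leffler_random_time {R : realType} {d} {T : measurableType d}
    {P : probability T R} (nu b l t : R) (tau : R -> {RV P >-> R}) :
  random_time b tau -> 0 < b <= 1 -> 0 < nu -> 0 < t -> 0 <= l ->
  P.-integrable setT (fun w => (mittag_leffler nu (- l * tau t w `^ nu))%:E) /\
  (\int[P]_w (mittag_leffler nu (- l * tau t w `^ nu))%:E =
   (mittag_leffler (nu * b) (- l * t `^ (nu * b)))%:E)%E.
Proof.
move=> rt b01 nu0 t0 l0; have [b0 _] := andP b01.
apply: (integral_mittag_leffler nu0 b0 l0 (measurable_funPT (tau t))).
  by move=> w; case: rt => + _ _; apply; exact: ltW.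
by move=> e e0; exact: (random_time_moment rt).
Qed.

(** Averaging [e^(-l x)] over [Tnu s] gives [mittag_leffler nu] at [- l s^nu]; averaging that over
    [s = Talpha t] gives order [nu * alpha]. The inner formula is known for [s > 0] only, so the
    integrands are compared almost everywhere. *)
Lemma integral_expR_composed_random_time {R : realType} {d} {T : measurableType d}
    {P : probability T R} (nu alpha l t : R) (Tnu Talpha : R -> {RV P >-> R}) :
  random_time nu Tnu -> 0 < nu <= 1 -> random_time alpha Talpha -> 0 < alpha <= 1 ->
  measurable_process Tnu -> 0 < t -> 0 <= l ->
  (forall A B, measurable A -> sigma_process Tnu B ->
    P (Talpha t @^-1` A `&` B) = (P (Talpha t @^-1` A) * P B)%E) ->
  let Z w := Tnu (Talpha t w) w in
  P.-integrable setT (fun w => (expR (- l * Z w))%:E) /\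
  (\int[P]_w (expR (- l * Z w))%:E =
   (mittag_leffler (nu * alpha) (- l * t `^ (nu * alpha)))%:E)%E.
Proof.
move=> rtn nu01 rta al01 mp t0 l0 ind Z; have [nu0 _] := andP nu01.
have Ta0 w : 0 <= Talpha t w by case: rta => + _ _; apply; exact: ltW.
pose f (x : R) : \bar R := (expR (- l * x))%:E.
have mf : measurable_fun setT f.
  apply/measurable_EFinP.
  exact: (measurableT_comp (@measurable_expR R) (mulrl_measurable (- l))).
have f0 x : (0 <= f x)%E by rewrite lee_fin expR_ge0.
have mT s : measurable_fun setT (Tnu s) by exact: measurable_funPT.
have [mZ /(_ mf f0)[mI H]] := subordination f mT mp (measurable_funPT (Talpha t)) Ta0 ind.
have inner s : 0 < s -> (\int[P]_v f (Tnu s v) = (mittag_leffler nu (- l * s `^ nu))%:E)%E.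
  move=> s0; have [_] := integral_mittag_leffler_random_time rtn nu01 ltr01 s0 l0.
  rewrite mul1r => <-; apply: eq_integral => v _.
  by rewrite mittag_leffler1 powRr1//; case: rtn => + _ _; apply; exact: ltW.
have [im imE] := integral_mittag_leffler_random_time rta al01 nu0 t0 l0.
have E : (\int[P]_w f (Z w) = (mittag_leffler (nu * alpha) (- l * t `^ (nu * alpha)))%:E)%E.
  rewrite H -imE; apply: ae_eq_integral => //; first exact: measurable_int im.
  by apply: filterS (random_time_gt0 rta al01 t0) => w Tw _ /=; exact: inner.
split=> //; apply/integrableP; split; first exact: (measurableT_comp mf mZ).
rewrite (_ : (\int[P]_w _)%E = (\int[P]_w f (Z w))%E); first by rewrite E ltry.
by apply: eq_integral => w _; rewrite gee0_abs.
Qed.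

Theorem mainTheorem8 (R : realType) (d : measure_display)
    (Omega : measurableType d) (P : probability Omega R)
    (nu alpha : R) (lam : nat -> R)
    (N Nnu Nnualpha : R -> {RV P >-> nat})
    (Tnu Talpha Tnualpha : R -> {RV P >-> R}) :
  0 < nu <= 1 -> 0 < alpha <= 1 ->
  (forall k, (1 <= k)%N -> 0 < lam k) ->
  (forall i j, (1 <= i)%N -> (1 <= j)%N -> lam i = lam j -> i = j) ->
  (\sum_(1 <= k <oo) (lam k)^-1%:E = +oo)%E ->
  pure_birth_process lam N ->
  fractional_pure_birth_process lam nu Nnu ->
  fractional_pure_birth_process lam (nu * alpha) Nnualpha ->
  random_time nu Tnu -> random_time alpha Talpha ->
  random_time (nu * alpha) Tnualpha ->
  measurable_process N -> measurable_process Nnu -> measurable_process Tnu ->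
  mutually_independent P
    [:: sigma_process Tnu; sigma_process Talpha; sigma_process N] ->
  forall t : R, 0 < t ->
  mutually_independent P
    [:: g_sigma_algebra_preimage (Talpha t); sigma_process Nnu] ->
  mutually_independent P
    [:: g_sigma_algebra_preimage (Tnualpha t); sigma_process N] ->
  let NnuT := fun w => Nnu (Talpha t w) w in
  [/\ eq_law P NnuT (fun w => N (Tnu (Talpha t w) w) w),
      eq_law P (fun w => N (Tnu (Talpha t w) w) w)
        (fun w => N (Tnualpha t w) w),
      eq_law P (fun w => N (Tnualpha t w) w) (Nnualpha t),
      forall k, (2 <= k)%N ->
        P [set w | NnuT w = k] =
        (\prod_(1 <= j < k) lam j *
         \sum_(1 <= m < k.+1)
           mittag_leffler (nu * alpha) (- lam m * t `^ (nu * alpha)) /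
           \prod_(1 <= l < k.+1 | l != m) (lam l - lam m))%:E &
      P [set w | NnuT w = 1%N] =
        (mittag_leffler (nu * alpha) (- lam 1%N * t `^ (nu * alpha)))%:E].
Proof.
move=> nu01 al01 lam0 inj lsum Npb Nnufb Nnafb rtn rta rtna mpN mpNn mpT indall t t0
  indn indna NnuT.
have [nu0 nu1] := andP nu01; have [al0 al1] := andP al01.
have na01 : 0 < nu * alpha <= 1 by rewrite mulr_gt0// mulr_ile1// ltW.
have Ta0 w : 0 <= Talpha t w by case: rta => + _ _; apply; exact: ltW.
have Tna0 w : 0 <= Tnualpha t w by case: rtna => + _ _; apply; exact: ltW.
pose Z w := Tnu (Talpha t w) w.
have Z0 w : 0 <= Z w by case: rtn => + _ _; apply.
have mN s : measurable_fun setT (N s) by exact: measurable_funPT.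
have mNn s : measurable_fun setT (Nnu s) by exact: measurable_funPT.
have mT s : measurable_fun setT (Tnu s) by exact: measurable_funPT.
have preE (tau : {RV P >-> R}) A : measurable A ->
    g_sigma_algebra_preimage tau (tau @^-1` A).
  by move=> mA; exists A => //; rewrite setTI.
have sTa A : measurable A -> sigma_process Talpha (Talpha t @^-1` A).
  move=> mA; apply: sub_sigma_algebra; exists t; first exact: ltW.
  exact: preE.
(* The sure event in the third slot reduces the triple product rule to independence of [Tnu] and
   [Talpha]. *)
have sTN : sigma_process N setT.
  by rewrite -[X in sigma_process N X]setC0 -setTD; apply: sigma_algebraCD; exact: sigma_algebra0.
have indTaTn A B : measurable A -> sigma_process Tnu B ->
    P (Talpha t @^-1` A `&` B) = (P (Talpha t @^-1` A) * P B)%E.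
  move=> mA sB; have := mutually_independent3 indall sB (sTa A mA) sTN.
  by rewrite setIT probability_setT mule1 setIC muleC.
have indTa A B : measurable A -> sigma_process Nnu B ->
    P (Talpha t @^-1` A `&` B) = (P (Talpha t @^-1` A) * P B)%E.
  by move=> mA; apply: (mutually_independent2 indn); exact: preE.
have indTna A B : measurable A -> sigma_process N B ->
    P (Tnualpha t @^-1` A `&` B) = (P (Tnualpha t @^-1` A) * P B)%E.
  by move=> mA; apply: (mutually_independent2 indna); exact: preE.
(* The full triple rule enters: given an event [B] of [N], the times [Tnu] and [Talpha] remain
   independent with unchanged laws, and so the law of [Z] is unchanged. *)
have indZ A B : measurable A -> sigma_process N B ->
    P (Z @^-1` A `&` B) = (P (Z @^-1` A) * P B)%E.
  move=> mA sB; apply: (subordination_indep mT mpT (measurable_funPT (Talpha t)) Ta0) => //.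
    exact: (sub_sigma_process mN).
  move=> A' B' mA' sB'; rewrite [X in P (X `&` _)]setIC.
  by rewrite (mutually_independent3 indall sB' (sTa A' mA') sB) [X in (X * _)%E]muleC.
have one (tau : Omega -> R) (l : R) : (forall w, 0 <= tau w) ->
    (fun w => (mittag_leffler 1 (- l * tau w `^ 1))%:E) = (fun w => (expR (- l * tau w))%:E).
  by move=> tau0; apply/funext => w; rewrite mittag_leffler1 powRr1.
have lawN s k : 0 <= s -> (1 <= k)%N ->
    P [set w | N s w = k] = (fractional_birth_prob lam 1 k s)%:E.
  by move=> s0 k1; rewrite (pure_birth_law _ _ lsum)// birth_probE.
have lawf b (X : R -> {RV P >-> nat}) : fractional_pure_birth_process lam b X ->
    forall s k, 0 <= s -> (1 <= k)%N ->
    P [set w | X s w = k] = (fractional_birth_prob lam b k s)%:E.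
  move=> fX s [|[|k]]// s0 _; have [_ X1 Xk] := fX s s0; last exact: Xk.
  by rewrite X1 fractional_birth_prob1.
(* The integrand [cst 0] is a placeholder, as only measurability of the composition is extracted. *)
have mZ : measurable_fun setT Z.
  exact: (subordination (cst 0%E) mT mpT (measurable_funPT (Talpha t)) Ta0 indTaTn).1.
have law1 k : (1 <= k)%N ->
    P [set w | NnuT w = k] = (fractional_birth_prob lam (nu * alpha) k t)%:E.
  apply: (subordinated_birth_law mpNn (measurable_funPT (Talpha t)) Ta0 indTa lam0
    (lawf _ _ Nnufb)).
  by move=> l l0; apply: (integral_mittag_leffler_random_time rta) => //; exact: ltW.
have law2 k : (1 <= k)%N ->
    P [set w | N (Z w) w = k] = (fractional_birth_prob lam (nu * alpha) k t)%:E.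
  apply: (subordinated_birth_law mpN mZ Z0 indZ lam0 lawN) => l l0.
  rewrite one//.
  exact: (integral_expR_composed_random_time rtn nu01 rta al01 mpT t0 (ltW l0) indTaTn).
have law3 k : (1 <= k)%N ->
    P [set w | N (Tnualpha t w) w = k] = (fractional_birth_prob lam (nu * alpha) k t)%:E.
  apply: (subordinated_birth_law mpN (measurable_funPT (Tnualpha t)) Tna0 indTna lam0 lawN).
  move=> l l0.
  by have := integral_mittag_leffler_random_time rtna na01 ltr01 t0 (ltW l0); rewrite mul1r.
have m1 := (subordination (cst 0%E) mNn mpNn (measurable_funPT (Talpha t)) Ta0 indTa).1.
have m2 := (subordination (cst 0%E) mN mpN mZ Z0 indZ).1.
have m3 := (subordination (cst 0%E) mN mpN (measurable_funPT (Tnualpha t)) Tna0 indTna).1.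
have N1 s w : 0 <= s -> (1 <= N s w)%N by case: Npb => + _ _; apply.
have Nn1 w : (1 <= NnuT w)%N by have [+ _ _] := Nnufb _ (Ta0 w); apply.
have Nna1 w : (1 <= Nnualpha t w)%N by have [+ _ _] := Nnafb _ (ltW t0); apply.
have NZ1 w : (1 <= N (Z w) w)%N by exact: N1.
have NT1 w : (1 <= N (Tnualpha t w) w)%N by exact: N1.
split.
- apply: (eq_law_pos_nat m1 m2 Nn1 NZ1) => k k1.
  by rewrite law1// -law2.
- apply: (eq_law_pos_nat m2 m3 NZ1 NT1) => k k1.
  by rewrite law3// -law2.
- apply: (eq_law_pos_nat m3 (measurable_funPT (Nnualpha t)) NT1 Nna1) => k k1.
  by rewrite law3// (lawf _ _ Nnafb)// ltW.
- by move=> k k2; rewrite law1 ?(ltnW k2).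
- by rewrite law1// fractional_birth_prob1.
Qed.
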